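(* Every group $\Gamma$ is (isomorphic to) the automorphism group $\mathrm{aut}(G)$ of a 2-connected partial double tree $G$ of radius 2. If the group $\Gamma$ is finite, the graph $G$ can be taken to be finite. Moreover, the automorphism group of this graph $G$ is isomorphic to the group of isometries of the geometric realization $|G|$, which is a ramified rectilinear polygon without cutpoints in the case that $G$ is finite.
   Context: Graphs are simple, undirected, possibly infinite. A partial double tree is a connected graph isometrically embeddable (for shortest-path metrics) into the Cartesian product of two trees (possibly infinite). The radius of a graph is the minimum over vertices $x$ of the maximum distance from $x$ to another vertex. The geometric realization $|G|$ of a partial double tree is the complex obtained from $G$ by replacing each edge by a unit segment and each 4-cycle by a solid unit square (partial double trees contain no 3-cubes), endowed with the intrinsic $l_1$-metric: the distance of $x$ and $y$ is the infimum of $\sum_i d(x_i,x_{i+1})$ over all sequences $x=x_0,\dots,x_m=y$ such that consecutive points lie in a common cell, $d(x_i,x_{i+1})$ being their $l_1$-distance in that cell. A rectangular complex is a cell complex of dimension at most 2 whose 2-cells are isometric to axis-parallel rectangles of the $l_1$-plane and whose 1-cells are segments, the sides of the rectangles being complete 1-cells, such that distinct cells intersect in the empty set or a common face. A dendron is a complete metric space that is Menger-convex (for distinct $x,y$ there is $z\ne x,y$ with $d(x,y)=d(x,z)+d(z,y)$) and in which any two distinct points are joined by a unique arc; it is a finite dendron if it is compact and has finitely many leaves (points whose removal does not separate any pair of points) and ramification points (points whose removal creates at least three arc-connected components). A ramified rectilinear polygon is a finite rectangular complex endowed with the intrinsic $l_1$-metric which embeds isometrically into the product of two finite dendrons (with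 the sum metric). A cutpoint is a point whose removal disconnects the space. *)

(* Defs.v *)
From HB Require Import structures.
From mathcomp Require Import all_boot all_order all_algebra.
From mathcomp Require Import all_classical all_reals all_analysis.

Set Implicit Arguments.
Unset Strict Implicit.
Unset Printing Implicit Defensive.

Import Order.TTheory GRing.Theory Num.Theory.
Import numFieldTopology.Exports.

Local Open Scope classical_set_scope.
Local Open Scope ring_scope.

(* For [d : X -> X -> S], the group of all permutations of [X] preserving [d];
   it is used for the adjacency relation of a graph ([S := bool]) and for the
   distance of a metric space. *)
Record symmetry (X S : Type) (d : X -> X -> S) := Symmetry {
  sym_fun :> X -> X;
  sym_inv : X -> X;
  sym_funK : cancel sym_fun sym_inv;
  sym_invK : cancel sym_inv sym_fun;
  sym_pres : forall x y, d (sym_fun x) (sym_fun y) = d x y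
}.

Section SymmetryGroup.
Variables (X S : Type) (d : X -> X -> S).
Implicit Types f g h : symmetry d.

Lemma symmetry_ext f g : sym_fun f =1 sym_fun g -> f = g.
Proof.
case: f g => [f f' fK f'K fd] [g g' gK g'K gd] /= /funext fg.
move: fK f'K fd; rewrite fg => fK f'K fd.
have f'g' : f' = g' by apply/funext => x; rewrite -[in LHS](g'K x) fK.
move: fK f'K; rewrite f'g' => fK f'K.
by congr Symmetry; exact: Prop_irrelevance.
Qed.

Fact sym_mul_pres f g x y : d (f (g x)) (f (g y)) = d x y.
Proof. by rewrite !sym_pres. Qed.

Fact sym_inv_pres f x y : d (sym_inv f x) (sym_inv f y) = d x y.
Proof. by rewrite -(sym_pres f) !sym_invK. Qed.

Definition sym_one : symmetry d :=
  @Symmetry X S d id id (fun=> erefl) (fun=> erefl) (fun _ _ => erefl).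

Definition sym_opp f : symmetry d :=
  Symmetry (@sym_invK _ _ _ f) (@sym_funK _ _ _ f) (sym_inv_pres f).

Definition sym_mul f g : symmetry d :=
  Symmetry (can_comp (@sym_funK _ _ _ f) (@sym_funK _ _ _ g))
           (can_comp (@sym_invK _ _ _ g) (@sym_invK _ _ _ f))
           (sym_mul_pres f g).

Fact sym_mulA : associative sym_mul.
Proof. by move=> f g h; apply: symmetry_ext. Qed.
Fact sym_mul1 : left_id sym_one sym_mul.
Proof. by move=> f; apply: symmetry_ext. Qed.
Fact sym_1mul : right_id sym_one sym_mul.
Proof. by move=> f; apply: symmetry_ext. Qed.
Fact sym_mulV : left_inverse sym_one sym_opp sym_mul.
Proof. by move=> f; apply: symmetry_ext => x /=; rewrite sym_funK. Qed.
Fact sym_Vmul : right_inverse sym_one sym_opp sym_mul.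
Proof. by move=> f; apply: symmetry_ext => x /=; rewrite sym_invK. Qed.

HB.instance Definition _ := gen_eqMixin (symmetry d).
HB.instance Definition _ := gen_choiceMixin (symmetry d).
HB.instance Definition _ := isGroup.Build (symmetry d)
  sym_mulA sym_mul1 sym_1mul sym_mulV sym_Vmul.

End SymmetryGroup.

Definition group_isomorphic (A B : groupType) : Prop :=
  exists f : {multiplicative A -> B}, bijective f.

Record sgraph := SGraph {
  vertex :> choiceType;
  adj : rel vertex;
  adj_sym : symmetric adj;
  adj_irrefl : irreflexive adj
}.

Definition aut (G : sgraph) : groupType := symmetry (@adj G).

Definition finite_graph (G : sgraph) : Prop := finite_set [set: G].

Section Graphs.
Variable G : sgraph.
Implicit Types (x y : G) (p : seq G) (n : nat).

Definition walk x y p : Prop := path (@adj G) x p /\ last x p = y.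

Definition graph_connected : Prop := forall x y, exists p, walk x y p.

Definition acyclic : Prop :=
  forall p, ucycle (@adj G) p -> (size p < 3)%N.

Definition tree : Prop := graph_connected /\ acyclic.

(* [n] is the shortest-path distance of [x] and [y]; no such [n] exists if [x]
   and [y] lie in different components. *)
Definition graph_dist x y n : Prop :=
  (exists2 p, walk x y p & size p = n) /\
  (forall p, walk x y p -> (n <= size p)%N).

Definition eccentricity x n : Prop :=
  (forall y, exists2 m, graph_dist x y m & (m <= n)%N) /\
  (exists y, graph_dist x y n).

Definition graph_radius n : Prop :=
  (exists x, eccentricity x n) /\
  (forall x m, eccentricity x m -> (n <= m)%N).

Definition two_connected : Prop :=
  [/\ exists x y z, [/\ x != y, y != z & x != z],
      graph_connected &
      forall v x y, x != v -> y != v -> exists2 p, walk x y p & v \notin p].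

End Graphs.

Section CartesianProduct.
Variables G H : sgraph.

Definition cart_adj : rel (G * H)%type := fun u v =>
  ((u.1 == v.1) && adj u.2 v.2) || (adj u.1 v.1 && (u.2 == v.2)).

Fact cart_adj_sym : symmetric cart_adj.
Proof.
move=> u v; rewrite /cart_adj (adj_sym u.1) (adj_sym u.2).
by rewrite (eq_sym u.1) (eq_sym u.2).
Qed.

Fact cart_adj_irrefl : irreflexive cart_adj.
Proof. by move=> u; rewrite /cart_adj !adj_irrefl andbF. Qed.

Definition cart_prod : sgraph := SGraph cart_adj_sym cart_adj_irrefl.

End CartesianProduct.

Definition isometric_embedding (G H : sgraph) (f : G -> H) : Prop :=
  forall x y n, graph_dist x y n <-> graph_dist (f x) (f y) n.

Definition partial_double_tree (G : sgraph) : Prop :=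
  graph_connected G /\
  exists T1 T2 : sgraph, [/\ tree T1, tree T2 &
    exists f : G -> cart_prod T1 T2, isometric_embedding f].

Definition l1box (R : realType) (s : R * R) : set (R * R) :=
  `[0, s.1] `*` `[0, s.2].

Definition l1dist (R : realType) (p q : R * R) : R :=
  `|p.1 - q.1| + `|p.2 - q.2|.

(* A space covered by cells, the cell [c] being identified through
   [cell_coord c] with the box [0, (sides c).1] x [0, (sides c).2] of the
   l1-plane; a box with one (resp. two) zero sides is a segment (resp. a
   point). Several indices may describe the same cell. The requirements on
   these data are stated in [rectangular_complex]. *)
Record l1_cells (R : realType) := L1Cells {
  carrier : Type;
  cell_index : Type;
  sides : cell_index -> R * R;
  cell : cell_index -> set carrier;
  cell_coord : cell_index -> carrier -> R * R
}.

Definition cell_space (R : realType) (K : l1_cells R) : Type := carrier K.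

Section IntrinsicMetric.
Variables (R : realType) (K : l1_cells R).
Implicit Types (x y z : cell_space K) (l m : R).

Definition step x y l : Prop := exists c : cell_index K,
  [/\ cell c x, cell c y & l = l1dist (cell_coord c x) (cell_coord c y)].

Inductive chain : cell_space K -> cell_space K -> R -> Prop :=
| chain_nil x : chain x x 0
| chain_cons x y z l m : step x y l -> chain y z m -> chain x z (l + m).

(* The value is [+oo] for points that are not joined by a chain. *)
Definition intrinsic_dist x y : \bar R :=
  ereal_inf [set l%:E | l in chain x y].

Definition intrinsic_ball x (e : R) : set (cell_space K) :=
  [set y | (intrinsic_dist x y < e%:E)%E].

Lemma chain_cat x y z l m : chain x y l -> chain y z m -> chain x z (l + m).
Proof.
elim=> [w|u v w k n uv _ ih] h; first by rewrite add0r.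
by rewrite -addrA; apply: chain_cons uv (ih h).
Qed.

Lemma step_sym x y l : step x y l -> step y x l.
Proof.
by case=> c [cx cy ->]; exists c; split=> //; rewrite /l1dist distrC
  [X in _ + X]distrC.
Qed.

Lemma chain_sym x y l : chain x y l -> chain y x l.
Proof.
elim=> [w|u v w k n uv _ ih]; first exact: chain_nil.
rewrite addrC; apply: chain_cat ih _; rewrite -[k]addr0.
by apply: chain_cons (chain_nil _); exact: step_sym.
Qed.

Lemma intrinsic_ballP x e y :
  intrinsic_ball x e y <-> exists2 l, chain x y l & l < e.
Proof.
split=> [/ereal_inf_lt[_ [l xyl <-]]|[l xyl le]]; first by exists l.
by apply: (@le_lt_trans _ _ l%:E) => //; apply: ereal_inf_lbound; exists l.
Qed.

Fact intrinsic_ball_center x (e : R) : 0 < e -> intrinsic_ball x e x.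
Proof. by move=> e0; apply/intrinsic_ballP; exists 0 => //; exact: chain_nil. Qed.

Fact intrinsic_ball_sym x y (e : R) :
  intrinsic_ball x e y -> intrinsic_ball y e x.
Proof.
by case/intrinsic_ballP=> l h le; apply/intrinsic_ballP; exists l => //;
  exact: chain_sym.
Qed.

Fact intrinsic_ball_triangle x y z (e1 e2 : R) :
  intrinsic_ball x e1 y -> intrinsic_ball y e2 z ->
  intrinsic_ball x (e1 + e2) z.
Proof.
case/intrinsic_ballP=> l hl le1 /intrinsic_ballP[m hm me2].
by apply/intrinsic_ballP; exists (l + m); [exact: chain_cat hl hm|exact: ltrD].
Qed.

HB.instance Definition _ := gen_eqMixin (cell_space K).
HB.instance Definition _ := gen_choiceMixin (cell_space K).
HB.instance Definition _ :=
  hasNbhs.Build (cell_space K) (nbhs_ (entourage_ intrinsic_ball)).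
HB.instance Definition _ := @Nbhs_isPseudoMetric.Build R (cell_space K)
  (entourage_ intrinsic_ball) erefl intrinsic_ball
  intrinsic_ball_center intrinsic_ball_sym intrinsic_ball_triangle erefl.

Definition isometry_group : groupType := symmetry intrinsic_dist.

Definition cutpoint x : Prop := ~ connected (~` [set x]).

End IntrinsicMetric.

Section RectangularComplex.
Variables (R : realType) (K : l1_cells R).
Implicit Types (i j : cell_index K) (A : set (cell_space K)).

Definition interval_face (a : R) (F : set R) : Prop :=
  [\/ F = [set 0], F = [set a] | F = `[0, a]%classic].

(* Every cell is a face of itself. *)
Definition face i A : Prop := exists F1 F2 : set R,
  [/\ interval_face (sides i).1 F1, interval_face (sides i).2 F2 &
      A = cell i `&` cell_coord i @^-1` (F1 `*` F2)].

Record rectangular_complex : Prop := {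
  rc_sides : forall i, 0 <= (sides i).1 /\ 0 <= (sides i).2;
  rc_coord : forall i, set_bij (cell i) (l1box (sides i)) (cell_coord i);
  rc_cover : forall x : cell_space K, exists i, cell i x;
  rc_face_cell : forall i A, face i A -> exists j, cell j = A;
  rc_face_metric : forall i j, face i (cell j) ->
    {in cell j &, forall x y,
      l1dist (cell_coord i x) (cell_coord i y) =
        l1dist (cell_coord j x) (cell_coord j y)};
  rc_meet : forall i j, cell i `&` cell j = set0 \/
    (face i (cell i `&` cell j) /\ face j (cell i `&` cell j))
}.

Definition finite_rectangular_complex : Prop :=
  rectangular_complex /\ finite_set (range (@cell R K)).

End RectangularComplex.

Section Dendrons.
Variables (R : realType) (D : metricType R).
Implicit Types (x y z : D) (A B : set D).

Definition complete_metric : Prop :=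
  forall F : set_system D, ProperFilter F -> cauchy F -> exists x, F --> x.

Definition menger_convex : Prop := forall x y, x != y ->
  exists z, [/\ z != x, z != y & mdist x y = mdist x z + mdist z y].

Definition is_arc x y A : Prop := exists g : R -> D,
  [/\ {within `[0, 1], continuous g}, {in `[0, 1] &, injective g},
      g 0 = x, g 1 = y & g @` `[0, 1] = A].

Definition dendron : Prop :=
  [/\ complete_metric, menger_convex &
      forall x y, x != y -> exists! A, is_arc x y A].

Definition arc_joined B x y : Prop :=
  x = y \/ exists2 A, is_arc x y A & A `<=` B.

Definition leaf x : Prop := forall y z, y != x -> z != x ->
  connected_component (~` [set x]) y z.

Definition ramification_point x : Prop := exists y1 y2 y3,
  [/\ y1 != x, y2 != x & y3 != x] /\
  [/\ ~ arc_joined (~` [set x]) y1 y2, ~ arc_joined (~` [set x]) y2 y3 &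
      ~ arc_joined (~` [set x]) y1 y3].

Definition finite_dendron : Prop :=
  [/\ dendron, compact [set: D], finite_set leaf &
      finite_set ramification_point].

End Dendrons.

Definition ramified_rectilinear_polygon (R : realType) (K : l1_cells R) :
    Prop :=
  finite_rectangular_complex K /\
  exists D1 D2 : metricType R, [/\ finite_dendron D1, finite_dendron D2 &
    exists (f1 : cell_space K -> D1) (f2 : cell_space K -> D2), forall x y,
      intrinsic_dist x y =
        (mdist (f1 x) (f1 y) + mdist (f2 x) (f2 y))%:E].

(* A square is indexed by a listing a, b, c, d of its 4-cycle, with corners
   a = (0,0), b = (1,0), c = (1,1) and d = (0,1). *)
Inductive gcell (G : sgraph) :=
| GVertex of G
| GEdge (u v : G) of adj u v
| GSquare (a b c d : G) of ucycle (@adj G) [:: a; b; c; d].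

Section Realization.
Variables (R : realType) (G : sgraph).

Definition gsides (k : gcell G) : R * R :=
  match k with
  | GVertex _ => (0, 0)
  | GEdge _ _ _ => (1, 0)
  | GSquare _ _ _ _ _ => (1, 1)
  end.

Definition at_vertex (v w : G) : R := (w == v)%:R.

(* A point of a cell is represented by the barycentric weights (bilinear, in
   the case of a square) that it gives to the vertices. This performs the
   gluing of the cells: a point of a common face has the same weights in all
   the cells containing it, while a point in the relative interior of a cell
   has exactly the vertices of that cell as support, so that it lies only in
   the cells having this one as a face. The latter uses that a 4-set of vertices
   carries at most one 4-cycle, which holds in every bipartite graph, hence in
   every partial double tree. *)
Definition gchart (k : gcell G) (p : R * R) : G -> R :=
  match k with
  | GVertex v => at_vertex v
  | GEdge u v _ => fun w =>
      (1 - p.1) * at_vertex u w + p.1 * at_vertex v w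
  | GSquare a b c d _ => fun w =>
      (1 - p.1) * (1 - p.2) * at_vertex a w + p.1 * (1 - p.2) * at_vertex b w +
      p.1 * p.2 * at_vertex c w + (1 - p.1) * p.2 * at_vertex d w
  end.

(* The inverse of [gchart k] on the box of the cell [k]. *)
Definition gcoord (k : gcell G) (x : G -> R) : R * R :=
  match k with
  | GVertex _ => (0, 0)
  | GEdge _ v _ => (x v, 0)
  | GSquare _ b c d _ => (x b + x c, x c + x d)
  end.

Lemma gchartK (k : gcell G) (p : R * R) :
  l1box (gsides k) p -> gcoord k (gchart k p) = p.
Proof.
case: p => s t; case: k => [v|u v uv|a b c d abcd] [/=].
- by rewrite !in_itv /= => /le_anti <- /le_anti <-.
- rewrite !in_itv /= => _ /le_anti <-; congr pair.
  rewrite /at_vertex eqxx mulr1; case: eqP => [E|_]; last by rewrite mulr0 add0r.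
  by move: uv; rewrite E adj_irrefl.
- move=> _ _; case/andP: abcd => _.
  rewrite /= !inE !negb_or -!andbA andbT => /and5P[ab ac ad bc /andP[bd cd]].
  have := (ab, ac, ad, (bc, bd, cd)).
  rewrite (eq_sym a b) (eq_sym a c) (eq_sym a d) (eq_sym b c) (eq_sym b d).
  rewrite (eq_sym c d) => -[[[ba ca] da] [[cb db] dc]].
  rewrite /at_vertex !eqxx.
  rewrite (negPf ba) (negPf ca) (negPf da) (negPf cb) (negPf db) (negPf dc).
  rewrite (negPf bc) (negPf bd) (negPf cd).
  rewrite !(mulr0, mulr1, add0r, addr0); congr pair.
    by rewrite -mulrDr subrK mulr1.
  by rewrite -mulrDl addrC subrK mul1r.
Qed.

Definition gpoint : Type :=
  {x : G -> R | exists k p, l1box (gsides k) p /\ x = gchart k p}.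

Definition realization : l1_cells R := {|
  carrier := gpoint;
  cell_index := gcell G;
  sides := gsides;
  cell := fun k => [set x : gpoint | exists2 p,
                      l1box (gsides k) p & sval x = gchart k p];
  cell_coord := fun k (x : gpoint) => gcoord k (sval x)
|}.

End Realization.

(* Main.v *)
From HB Require Import structures.
Require Import Defs.
From mathcomp Require Import all_boot all_order all_algebra.
From mathcomp Require Import all_classical all_reals all_analysis.
From mathcomp Require Import lra ring.
From mathcomp Require wochoice.

(** Let B be the incidence graph of a system of points and blocks. Its
    simplex graph G consists of the empty set (the cone), the vertices of B and
    the edges of B (the corners). It is an isometric subgraph of the product of
    two stars, one with a leaf for every point and one with a leaf for every
    block. The cone is the only vertex of eccentricity 2, so automorphisms of G
    are automorphisms of B; for a suitable B these are the left translations of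
    the given group. The cells of |G| are products of cells of the two stars,
    and geodesics may be routed through the axes, so |G| is isometric to a
    subspace of the l1-product of the geometric realizations of the stars. In
    |G| the cone is the only point of eccentricity at most 2, the corners are
    the points at distance 2 from it, and the points and blocks are the points
    at distance 1 from the cone and from at least two corners. Hence isometries
    permute the vertices of G, and they are determined by this permutation.  *)

Set Implicit Arguments.
Unset Strict Implicit.
Unset Printing Implicit Defensive.

Import Order.TTheory GRing.Theory Num.Theory.
Import numFieldNormedType.Exports.

(** * Simplex graphs of bipartite incidence structures *)

(** Representing a group by a graph usually means replacing the arcs of a coloured Cayley graph by
    rigid gadgets, one shape per colour. Radius 2 leaves no room for long gadgets in G, and the
    number of colours may be any cardinal. The way out is that cone and corners force radius 2 for a
    wide choice of B, while B can be read off from G; so all coding is done in the bipartite graph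
    B, where diameter is no concern. The arcs of the complete Cayley graph become points, and their
    colours are recorded by an increasing family of blocks indexed by a well-order of the group,
    because a well-order of any size has no automorphism but the identity. A block [Omega] on all
    points has two tasks: it tells blocks from points, and it holds G and |G| together when the cone
    is removed. Every point lies on two blocks and every block carries two points; this makes the
    cone the only centre, both in G and in |G|, and lets isometries recognize points and blocks. *)

Section Distance.
Variable G : sgraph.
Implicit Types x y : G.

Lemma walk_cat x y z p q : walk x y p -> walk y z q -> walk x z (p ++ q).
Proof.
by case=> xp <- [yq lq]; split; rewrite ?cat_path ?xp ?last_cat.
Qed.

Lemma walk_step x y : adj x y -> walk x y [:: y].
Proof. by move=> xy; split; rewrite //= xy. Qed.

Lemma walk_sym x y p : walk x y p ->
  exists q, [/\ walk y x q, size q = size p & {subset q <= x :: p}].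
Proof.
elim: p x => [|z p ih] x [] /= => [_ <-|]; first by exists [::].
move=> /andP[xz zp] l; have [q [yzq sq sub]] := ih z (conj zp l).
exists (rcons q x); split.
- rewrite -cats1; apply: walk_cat yzq _; apply: walk_step; by rewrite adj_sym.
- by rewrite size_rcons sq.
- move=> w; rewrite mem_rcons !inE => /orP[->//|/sub].
  by rewrite inE => ->; rewrite orbT.
Qed.

Variable d : G -> G -> nat.
Hypothesis dxx : forall x, d x x = 0.
Hypothesis d_adj : forall x y z, adj x y -> d x z <= (d y z).+1.
Hypothesis d_desc : forall x y, x != y -> exists2 z, adj x z & (d z y).+1 <= d x y.

(** A certificate for distances: [d_adj] makes [d] a lower bound for the length of every walk, and
    following [d_desc] until the ends meet gives a walk that attains it. *)
Lemma graph_distE x y n : graph_dist x y n <-> n = d x y.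
Proof.
have lb u v p : walk u v p -> d u v <= size p.
  elim: p u => [|w p ih] u [] /= => [_ ->|]; first by rewrite dxx.
  move=> /andP[uw wp] l; apply: leq_trans (d_adj v uw) _.
  by rewrite ltnS; apply: ih.
have ub k : forall u v, d u v <= k -> exists2 p, walk u v p & size p <= k.
  elim: k => [|k ih] u v uv.
    case: (eqVneq u v) => [<-|/d_desc[z _]]; first by exists [::].
    by move: uv; rewrite leqn0 => /eqP ->; rewrite ltn0.
  case: (eqVneq u v) => [<-|/d_desc[z uz zv]]; first by exists [::].
  have [|p [zp lp] sp] := ih z v; first by rewrite -ltnS (leq_trans zv).
  by exists (z :: p); rewrite //=; split => //=; rewrite uz.
split=> [[[p xyp <-] h]|->].
  have [q /h le1 le2] := ub _ x y (leqnn _).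
  by apply/eqP; rewrite eqn_leq lb// (leq_trans le1 le2).
split; last by move=> p /lb.
have [q xyq le] := ub _ x y (leqnn _); exists q => //.
by apply/eqP; rewrite eqn_leq le lb.
Qed.

End Distance.

(** * Stars, and the simplex graph as an isometric subgraph of a product of two stars *)

Section Star.
Variable A : choiceType.

Definition star_adj : rel (option A) := fun x y => (x == None) != (y == None).

Fact star_adj_sym : symmetric star_adj.
Proof. by move=> x y; rewrite /star_adj eq_sym. Qed.

Fact star_adj_irrefl : irreflexive star_adj.
Proof. by move=> x; rewrite /star_adj eqxx. Qed.

Definition star_graph : sgraph := SGraph star_adj_sym star_adj_irrefl.

Definition star_dist (x y : option A) : nat :=
  if x == y then 0 else if (x == None) || (y == None) then 1 else 2.

Lemma star_adjE (x y : option A) : star_adj x y = (star_dist x y == 1).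
Proof.
by rewrite /star_adj /star_dist; case: x y => [a|] [b|] //=; case: ifP.
Qed.

Lemma star_dist_triangle (x y z : option A) :
  star_dist x z <= star_dist x y + star_dist y z.
Proof.
rewrite /star_dist; case: (eqVneq x y) => [->//|xy].
case: (eqVneq x z) => [//|xz]; case: (eqVneq y z) => [<-|yz].
  by rewrite addn0.
by do 3 case: ifP.
Qed.

Lemma star_tree : tree star_graph.
Proof.
split.
  have toN (x : star_graph) : exists p, walk x (None : star_graph) p.
    by case: x => [a|]; [exists [:: None : star_graph]|exists [::]].
  move=> x y; have [p xp] := toN x; have [q /walk_sym[q' [yq _ _]]] := toN y.
  by exists (p ++ q'); exact: walk_cat xp yq.
(* Exactly one end of each edge is [None], so [None] alternates with leaves along a cycle. With
   three or more vertices it would occur twice, or two leaves would be adjacent. *)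
case=> [|x [|y [|z p]]] // /andP[/= /andP[xy /andP[yz zp]] /and3P[]].
rewrite !inE !negb_or => /and3P[xy' xz _] /andP[_ yp] _.
move: xy yz zp xy' xz yp; rewrite /star_adj.
case: x y z => [a|] [b|] [c|] // _ _.
by case: p => [|[d|] p] //=; rewrite inE eqxx.
Qed.

End Star.

Section BallGraph.
Variables A C : choiceType.
Variable inc : A -> C -> bool.

Definition compat (u : option A * option C) : bool :=
  if u is (Some a, Some c) then inc a c else true.

Definition ball_vertex := {u : option A * option C | compat u}.

Definition ball_adj : rel ball_vertex := fun u v =>
  @cart_adj (star_graph A) (star_graph C) (val u) (val v).

Fact ball_adj_sym : symmetric ball_adj.
Proof. by move=> u v; exact: cart_adj_sym. Qed.

Fact ball_adj_irrefl : irreflexive ball_adj.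
Proof. by move=> u; exact: cart_adj_irrefl. Qed.

Definition ball_graph : sgraph := SGraph ball_adj_sym ball_adj_irrefl.

Definition pdist (u v : option A * option C) :=
  star_dist u.1 v.1 + star_dist u.2 v.2.

Lemma cart_pdist (u v : option A * option C) :
  @cart_adj (star_graph A) (star_graph C) u v = (pdist u v == 1).
Proof.
case: u v => [i j] [p p']; rewrite /cart_adj /= !star_adjE /pdist /= /star_dist.
by case: (eqVneq i p) => [_|hi]; case: (eqVneq j p') => [_|hj] //=;
  do ! case: ifP => //=.
Qed.

Lemma pdist_triangle u v w : pdist u w <= pdist u v + pdist v w.
Proof.
rewrite /pdist addnACA; apply: leq_add; exact: star_dist_triangle.
Qed.

Lemma pdist_xx u : pdist u u = 0.
Proof. by rewrite /pdist /star_dist !eqxx. Qed.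

Lemma cart_graph_dist (u v : cart_prod (star_graph A) (star_graph C)) n :
  graph_dist u v n <-> n = pdist u v.
Proof.
apply: (@graph_distE (cart_prod (star_graph A) (star_graph C))) => [x|x y z xy|x y xy].
- exact: pdist_xx.
- apply: leq_trans (pdist_triangle _ y _) _.
  by move: xy; rewrite /= cart_pdist => /eqP ->.
- suff [z xz le] : exists2 z, pdist x z == 1 & (pdist z y).+1 <= pdist x y.
    by exists z => //; rewrite /= cart_pdist.
  case: x y xy => [i p] [j p']; rewrite /pdist /star_dist /=.
  case: (eqVneq i j) => [<-|ij] ne.
    have pp' : p != p' by apply: contraNneq ne => ->.
    case: p pp' {ne} => [c|] pp'; last first.
      by exists (i, p'); rewrite /= ?eqxx //= (negPf pp') //=; case: ifP.
    exists (i, None); rewrite /= ?eqxx //= (negPf pp') /=.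
    by case: p' pp' => [?|].
  case: i ij {ne} => [a|] ij; last first.
    by exists (j, p); rewrite /= ?eqxx //= (negPf ij).
  exists (None, p); rewrite /= ?eqxx //=.
  by case: j ij => [?|] //= ij; rewrite ltnS.
Qed.

(** The descent can stay within compatible pairs: a differing coordinate on a leaf is moved to
    [None], which cannot break compatibility. A coordinate moves outward only when no differing
    coordinate is on a leaf, and then the new pair has each coordinate equal to [None] or to that of
    the target. *)
Lemma ball_graph_dist (u v : ball_graph) n :
  graph_dist u v n <-> n = pdist (val u) (val v).
Proof.
apply: (@graph_distE ball_graph (fun u v => pdist (val u) (val v)))
   => [x|x y z xy|x y xy].
- exact: pdist_xx.
- apply: leq_trans (pdist_triangle _ (val y) _) _.
  by move: xy; rewrite /= /ball_adj cart_pdist => /eqP ->.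
- suff [z [cz xz le]] : exists z, [/\ compat z,
      pdist (val x) z == 1 & (pdist z (val y)).+1 <= pdist (val x) (val y)].
    by exists (exist _ z cz : ball_graph); rewrite //= /ball_adj cart_pdist.
  move: xy; rewrite -val_eqE; case: x y => [[i p] /= hi] [[j p'] /= hj].
  rewrite /pdist /star_dist /=.
  case: (eqVneq i j) => [E|ij] ne.
    have pp' : p != p' by apply: contraNneq ne => ->; rewrite E.
    case: p hi pp' {ne} => [c|] hi pp'; last first.
      exists (i, p'); split; rewrite /= ?E ?eqxx //= (negPf pp') //=.
    exists (i, None); split; rewrite /= ?E ?eqxx //=; first by case: (j) hi.
    by rewrite (negPf pp') /=; case: p' pp' {hj}.
  case: i hi ij {ne} => [a|] hi ij; last first.
    case: (eqVneq p p') => [E|pp'].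
      by exists (j, p'); split; rewrite /= ?E ?eqxx //= (negPf ij).
    case: p hi pp' => [c|] hi pp'.
      exists (None, None); split; rewrite /= ?eqxx //= (negPf ij) /=.
      by case: p' pp' {hj}.
    exists (j, None); split; rewrite /= ?eqxx //=; first by case: (j) hi.
    by rewrite (negPf ij); case: (p').
    by case: (p').
  exists (None, p); split; rewrite /= ?eqxx //=.
  by case: j ij {hj} => [?|] //= ij; rewrite ltnS.
Qed.

Definition cone : ball_graph := exist _ (None, None) isT.
Definition lvert (a : A) : ball_graph := exist _ (Some a, None) isT.
Definition rvert (c : C) : ball_graph := exist _ (None, Some c) isT.
Definition corner (a : A) (c : C) (ac : inc a c) : ball_graph :=
  exist _ (Some a, Some c) ac.

Variant ball_vertex_spec : ball_graph -> Type :=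
| BallCone : ball_vertex_spec cone
| BallL a : ball_vertex_spec (lvert a)
| BallR c : ball_vertex_spec (rvert c)
| BallCorner a c (ac : inc a c) : ball_vertex_spec (corner ac).

Lemma ball_vertexP (u : ball_graph) : ball_vertex_spec u.
Proof.
case: u => -[[a|] [c|]] ac; first exact: (BallCorner ac).
- have -> : exist _ (Some a, None) ac = lvert a by apply: val_inj.
  exact: BallL.
- have -> : exist _ (None, Some c) ac = rvert c by apply: val_inj.
  exact: BallR.
- have -> : exist _ (None, None) ac = cone by apply: val_inj.
  exact: BallCone.
Qed.

Hypothesis inc_l : forall a c, exists2 c', c' != c & inc a c'.
Hypothesis inc_r : forall c a, exists2 a', a' != a & inc a' c.
Variables (c0 : C) (a0 : A).
Hypothesis inc_c0 : forall a, inc a c0.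

Lemma ball_connected : graph_connected ball_graph.
Proof.
move=> x y.
have [_ /(_ erefl)[[p xyp _] _]] := ball_graph_dist x y (pdist (val x) (val y)).
by exists p.
Qed.

Lemma ball_partial_double_tree : partial_double_tree ball_graph.
Proof.
split; first exact: ball_connected.
exists (star_graph A), (star_graph C); split; [exact: star_tree|exact: star_tree|].
exists val => x y n.
by split=> [/ball_graph_dist/cart_graph_dist//|/cart_graph_dist/ball_graph_dist].
Qed.

Lemma ball_radius : graph_radius ball_graph 2.
Proof.
have conele (y : ball_graph) : pdist (None, None) (val y) <= 2.
  by case: (ball_vertexP y).
split.
  exists cone; split=> [y|].
    by exists (pdist (val cone) (val y)); [exact/ball_graph_dist|exact: conele].
  by exists (corner (inc_c0 a0)); apply/ball_graph_dist.
move=> x m [h _].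
suff [y] : exists y : ball_graph, 2 <= pdist (val x) (val y).
  by move/leq_trans; apply; have [k /ball_graph_dist ->] := h y.
case: (ball_vertexP x) => [|a|c|a c ac].
- by exists (corner (inc_c0 a0)).
(* Two leaves of one star are at distance 2; [inc_r] supplies a second point. *)
- have [a' aa' _] := inc_r c0 a; exists (lvert a').
  rewrite /pdist /star_dist /= (inj_eq (@Some_inj _)) eq_sym (negPf aa').
  by [].
- have [c' cc' _] := inc_l a0 c; exists (rvert c').
  rewrite /pdist /star_dist /= (inj_eq (@Some_inj _)) eq_sym (negPf cc').
  by [].
- by exists cone.
Qed.

(** Without the cone, each point reaches the block [c0] through its corner with [c0], and each block
    or corner reaches a point. Without another vertex, points and blocks are still adjacent to the
    cone, and a corner leaves through whichever of its point and its block remains. *)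
Lemma ball_two_connected : two_connected ball_graph.
Proof.
split.
- exists cone, (lvert a0), (rvert c0); split=> //.
- exact: ball_connected.
move=> v.
have joinv x y z : (exists2 p, walk x y p & v \notin p) ->
    (exists2 p, walk y z p & v \notin p) ->
    exists2 p, walk x z p & v \notin p.
  move=> [p xy vp] [q yz vq]; exists (p ++ q); first exact: walk_cat xy yz.
  by rewrite mem_cat negb_or vp.
(* The list of a walk omits its start, which becomes the end of the reversed walk; hence the
   condition on [x]. *)
have sym x y : x != v -> (exists2 p, walk x y p & v \notin p) ->
    (exists2 p, walk y x p & v \notin p).
  move=> xv [p /walk_sym[q [yxq _ sub]] vp]; exists q => //.
  apply/negP => /sub; rewrite inE eq_sym (negPf xv) /=; exact/negP.
have step x y : adj x y -> y != v -> exists2 p, walk x y p & v \notin p.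
  by move=> xy yv; exists [:: y]; [exact: walk_step|rewrite inE eq_sym].
have toL a c ac : @adj ball_graph (@corner a c ac) (lvert a).
  by rewrite /= /ball_adj /cart_adj /= /star_adj /= eqxx.
have toR a c ac : @adj ball_graph (@corner a c ac) (rvert c).
  by rewrite /= /ball_adj /cart_adj /= /star_adj /= eqxx.
have refl (x : ball_graph) : exists2 p, walk x x p & v \notin p.
  by exists [::].
suff [b hb] : exists b, b != v /\ forall x, x != v ->
    exists2 p, walk x b p & v \notin p.
  move=> x y xv yv; apply: (joinv _ _ _ (hb.2 x xv)).
  by apply: (sym _ _ yv); exact: (hb.2 y yv).
case: (eqVneq v cone) => [vE|nvE].
  exists (rvert c0); split; first by rewrite vE.
  have hL a : exists2 p, walk (lvert a) (rvert c0) p & v \notin p.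
    apply: (joinv _ (corner (inc_c0 a))).
      by apply: step; [rewrite adj_sym; exact: toL|rewrite vE].
    by apply: step; [exact: toR|rewrite vE].
  move=> x; case: (ball_vertexP x) => [|a|c|a c ac]; first by rewrite vE eqxx.
  - by move=> _; exact: hL.
  - move=> _; have [a _ ac] := inc_r c a0; apply: (joinv _ _ _ _ (hL a)).
    apply: (joinv _ (corner ac)).
      by apply: step; [rewrite adj_sym; exact: toR|rewrite vE].
    by apply: step; [exact: toL|rewrite vE].
  - by move=> _; apply: (joinv _ _ _ _ (hL a)); apply: step; [exact: toL|rewrite vE].
exists cone; split; first by rewrite eq_sym.
have hL a : exists2 p, walk (lvert a) cone p & v \notin p.
  by apply: step; rewrite // eq_sym.
have hR c : exists2 p, walk (rvert c) cone p & v \notin p.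
  by apply: step; rewrite // eq_sym.
move=> x; case: (ball_vertexP x) => [|a|c|a c ac] xv //.
case: (eqVneq v (lvert a)) => [vE|nv].
  by apply: (joinv _ _ _ _ (hR c)); apply: step; [exact: toR|rewrite vE].
by apply: (joinv _ _ _ _ (hL a)); apply: step; [exact: toL|rewrite eq_sym].
Qed.

End BallGraph.

Lemma bijective_group_isomorphic (U V : groupType) (f : U -> V) :
  {morph f : x y / (x * y)%g} -> bijective f -> group_isomorphic U V.
Proof.
move=> fM fb; pose m := isMultiplicative.Build U V f fM.
pose F : {multiplicative U -> V} := HB.pack f m.
by exists F.
Qed.

Ltac adjE := rewrite /= /ball_adj /cart_adj /= /star_adj /= ?(andbF, andbT, orbF).

(** * Automorphisms of the simplex graph and of the incidence structure *)

Section BallAut.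
Variables (A C : choiceType) (inc : A -> C -> bool).
Local Notation G := (ball_graph inc).

Definition incidence (s t : A + C) : bool :=
  match s, t with
  | inl a, inr c => inc a c
  | inr c, inl a => inc a c
  | _, _ => false
  end.

Definition bvert (s : A + C) : G :=
  match s with inl a => lvert inc a | inr c => rvert inc c end.

Lemma bvert_inj : injective bvert.
Proof. by move=> [a|c] [b|d] // [->]. Qed.

Lemma adj_cone (x : G) : adj (cone inc) x -> exists s, x = bvert s.
Proof.
case: (ball_vertexP x) => [|a|c|a c ac] //=.
- by exists (inl a).
- by exists (inr c).
Qed.

Lemma adj_cone_bvert s : adj (cone inc) (bvert s).
Proof. by case: s. Qed.

(** Expresses incidence by adjacency and the cone alone, so that every automorphism fixing the cone
    respects it. *)
Lemma incidence_corner s t : incidence s t <->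
  s <> t /\ exists w : G, [/\ w <> cone inc, adj (bvert s) w & adj (bvert t) w].
Proof.
split.
  case: s t => [a|c] [b|d] //= h; split=> //.
    exists (corner h); split=> //;
    by rewrite /= /ball_adj /cart_adj /= ?eqxx /star_adj ?eqxx ?orbT.
  exists (corner h); split=> //;
  by rewrite /= /ball_adj /cart_adj /= ?eqxx /star_adj ?eqxx ?orbT.
case=> st [w []]; case: (ball_vertexP w) => // [a|c|a c ac] _.
- by case: s t st => [b|b] [d|d]; adjE.
- by case: s t st => [b|b] [d|d]; adjE.
case: s t st => [b|b] [d|d] //=; adjE.
- by move=> st /eqP[E] /eqP[E']; case: st; rewrite E E'.
- by move=> st /eqP[->] /eqP[->].
- by move=> st /eqP[->] /eqP[->].
- by move=> st /eqP[E] /eqP[E']; case: st; rewrite E E'.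
Qed.

Hypothesis inc_l : forall a c, exists2 c', c' != c & inc a c'.
Hypothesis inc_r : forall c a, exists2 a', a' != a & inc a' c.
Variables (c0 : C) (a0 : A).
Hypothesis inc_c0 : forall a, inc a c0.

(** Every other vertex has a corner at distance at least 3: a point has a corner with another point,
    a block has one with another block, and a corner has one that differs in both coordinates. *)
Lemma cone_center (x : G) : x = cone inc <->
  forall y, [\/ x = y, adj x y | exists2 z, adj x z & adj z y].
Proof.
split=> [->|h].
  move=> y; case: (ball_vertexP y) => [|a|c|a c ac]; first by constructor 1.
  - by constructor 2.
  - by constructor 2.
  - constructor 3; exists (lvert inc a) => //.
    by rewrite /= /ball_adj /cart_adj /= eqxx.
have far a c (ac : inc a c) a' c' (ac' : inc a' c') :
    (a != a') -> (c != c') -> ~ x = corner ac.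
  move=> aa cc xE; case: (h (corner ac')); rewrite xE.
  - by case=> E; move: aa; rewrite E eqxx.
  - by rewrite /= /ball_adj /cart_adj /= /star_adj /= andbF.
  - case=> z; case: (ball_vertexP z) => [|b|d|b d bd] //=;
    adjE => //.
    + by move=> /eqP[<-] /eqP[E]; move: aa; rewrite E eqxx.
    + by move=> /eqP[<-] /eqP[E]; move: cc; rewrite E eqxx.
case: (ball_vertexP x) (far) h => [|a|c|a c ac] // {}far h.
- have [b ba bc0] := inc_r c0 a.
  have := h (corner bc0); case=> //=; adjE.
    by move=> /eqP[E]; move: ba; rewrite E eqxx.
  case=> z; case: (ball_vertexP z) => [|b'|d|b' d bd] //=;
  adjE => //.
- have [d dc a0d] := inc_l a0 c.
  have := h (corner a0d); case=> //=; adjE.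
    by move=> /eqP[E]; move: dc; rewrite E eqxx.
  case=> z; case: (ball_vertexP z) => [|b'|d'|b' d' bd] //=;
  adjE => //.
- have [b ba _] := inc_r c0 a; have [d dc bd] := inc_l b c.
  by exfalso; apply: (far _ _ ac _ _ bd) => //; rewrite eq_sym.
Qed.

Lemma corner_unique a c (w : G) : inc a c -> w <> cone inc ->
  adj (lvert inc a) w -> adj (rvert inc c) w -> val w = (Some a, Some c).
Proof.
move=> ac; case: (ball_vertexP w) => [//|b|d|b d bd] _; adjE => //.
by move=> /eqP[->] /eqP[->].
Qed.

Section Automorphism.
Variable f : aut G.

Lemma aut_cone : f (cone inc) = cone inc.
Proof.
apply/cone_center => y; rewrite -[y](sym_invK f).
have /cone_center /(_ (sym_inv f y)) [->|h|[z h1 h2]] := erefl (cone inc).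
- by constructor 1.
- by constructor 2; rewrite sym_pres.
- by constructor 3; exists (f z); rewrite sym_pres.
Qed.

Lemma aut_bvert : exists2 psi : A + C -> A + C, bijective psi &
  (forall s, f (bvert s) = bvert (psi s)) /\
  (forall s t, incidence (psi s) (psi t) = incidence s t).
Proof.
have h (g : aut G) : g (cone inc) = cone inc -> forall s, exists t, g (bvert s) = bvert t.
  move=> gc s; apply: adj_cone; rewrite -gc sym_pres; exact: adj_cone_bvert.
have [psi psiE] := choice (h f aut_cone).
have fi : sym_inv f (cone inc) = cone inc by rewrite -{1}aut_cone sym_funK.
have [psi' psi'E] := choice (h (sym_opp f) fi).
have K : cancel psi psi' by move=> s; apply: bvert_inj; rewrite -psi'E -psiE /= sym_funK.
have K' : cancel psi' psi.
  by move=> s; apply: bvert_inj; rewrite -psiE -psi'E /= sym_invK.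
exists psi; [by exists psi'|split=> // s t].
apply/idP/idP => /incidence_corner[st [w [wc sw tw]]]; apply/incidence_corner.
  split; first by move=> E; apply: st; rewrite E.
  exists (sym_inv f w).
  rewrite -(sym_pres f (bvert s)) -(sym_pres f (bvert t)) !sym_invK !psiE; split=> //.
  by move=> E; apply: wc; rewrite -(sym_invK f w) E aut_cone.
split; first by move=> E; apply: st; apply: (can_inj K).
exists (f w); rewrite -!psiE !sym_pres; split=> //.
by rewrite -aut_cone => E; apply: wc; apply: (can_inj (sym_funK f)).
Qed.

(** Points and blocks cannot be exchanged, because the block [c0] carries all points while no point
    lies on all blocks. *)
Lemma aut_sides : (forall a, exists c, ~~ inc a c) ->
  exists (al : A -> A) (be : C -> C), [/\ bijective al, bijective be,
    forall a, f (lvert inc a) = lvert inc (al a),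
    forall c, f (rvert inc c) = rvert inc (be c) &
    forall a c, inc (al a) (be c) = inc a c].
Proof.
move=> nfull; have [psi [psi' K K'] [psiE psi_inc]] := aut_bvert.
have [c1 c1E] : exists c1, psi (inr c0) = inr c1.
  case E : (psi (inr c0)) => [a|c1]; last by exists c1.
  (* If [c0] went to a point [a], all points would go to blocks on [a]. The block [c] missed by [a]
     would then be the image of a block; but that block carries a point, whose image is a block too,
     and two blocks are never incident. *)
  have al a' : exists2 c, psi (inl a') = inr c & inc a c.
    have := psi_inc (inr c0) (inl a'); rewrite E /= inc_c0.
    by case: (psi (inl a')) => // c ac; exists c.
  have [c /negP[]] := nfull a.
  have := K' (inr c); case: (psi' (inr c)) => [a' E'|c'].
    by have [c2] := al a'; rewrite E' => -[->].
  have [a' _ a'c'] := inc_r c' a0; have := psi_inc (inl a') (inr c').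
  by have [c2 -> _] /= := al a'; rewrite a'c' => + E'; rewrite E'.
have psil a : exists b, psi (inl a) = inl b.
  have := psi_inc (inr c0) (inl a); rewrite c1E /= inc_c0.
  by case: (psi (inl a)) => // b _; exists b.
have psir c : exists d, psi (inr c) = inr d.
  have [a _ ac] := inc_r c a0.
  have := psi_inc (inl a) (inr c); have [b ->] := psil a; rewrite /= ac.
  by case: (psi (inr c)) => // d _; exists d.
have [al alE] := choice psil; have [be beE] := choice psir.
have psil' a : exists b, psi' (inl a) = inl b.
  have := K' (inl a); case: (psi' (inl a)) => [b _|c]; first by exists b.
  by rewrite beE.
have psir' c : exists d, psi' (inr c) = inr d.
  have := K' (inr c); case: (psi' (inr c)) => [a|d _]; last by exists d.
  by rewrite alE.
have [al' alE'] := choice psil'; have [be' beE'] := choice psir'.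
exists al, be; split.
- exists al'.
    by move=> a; have := K (inl a); rewrite alE alE' => -[].
  by move=> a; have := K' (inl a); rewrite alE' alE => -[].
- exists be'.
    by move=> a; have := K (inr a); rewrite beE beE' => -[].
  by move=> a; have := K' (inr a); rewrite beE' beE => -[].
- by move=> a; rewrite -/(bvert (inl a)) psiE alE.
- by move=> c; rewrite -/(bvert (inr c)) psiE beE.
- by move=> a c; have := psi_inc (inl a) (inr c); rewrite alE beE.
Qed.

End Automorphism.

(** The cone is fixed anyway, and a corner is the only common neighbour of its point and its block
    besides the cone. *)
Lemma aut_eq (f g : aut G) :
  (forall a, f (lvert inc a) = g (lvert inc a)) ->
  (forall c, f (rvert inc c) = g (rvert inc c)) -> f = g.
Proof.
move=> fgl fgr; apply: symmetry_ext => x.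
case: (ball_vertexP x) => [|a|c|a c ac] //; first by rewrite !aut_cone.
apply: (can_inj (sym_invK g)); rewrite sym_funK; apply: val_inj => /=.
apply: corner_unique => //.
- move=> E; have : f (corner ac) = g (cone inc) by rewrite -E sym_invK.
  by rewrite aut_cone -(aut_cone f) => /(can_inj (sym_funK f)).
- by rewrite -(sym_pres g) sym_invK -fgl sym_pres; adjE; rewrite eqxx.
- by rewrite -(sym_pres g) sym_invK -fgr sym_pres; adjE; rewrite eqxx.
Qed.

Lemma incidence_aut_exists (al al' : A -> A) (be be' : C -> C) :
  cancel al al' -> cancel al' al -> cancel be be' -> cancel be' be ->
  (forall a c, inc (al a) (be c) = inc a c) ->
  exists f : aut G, forall x, val (f x) = (omap al (val x).1, omap be (val x).2).
Proof.
move=> alK alK' beK beK' h.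
have hok al1 be1 : (forall a c, inc (al1 a) (be1 c) = inc a c) -> forall x : G,
    compat inc (omap al1 (val x).1, omap be1 (val x).2).
  by move=> h1 [[[a|] [c|]] //= ac]; rewrite h1.
have h' a c : inc (al' a) (be' c) = inc a c by rewrite -h alK' beK'.
pose F (x : G) : G := (exist _ (omap al (val x).1, omap be (val x).2) (hok _ _ h x) : ball_vertex inc).
pose F' (x : G) : G := (exist _ (omap al' (val x).1, omap be' (val x).2) (hok _ _ h' x) : ball_vertex inc).
have FK : cancel F F'.
  by case=> [[[a|] [c|]] ac]; apply: val_inj; rewrite /= ?alK ?beK.
have FK' : cancel F' F.
  by case=> [[[a|] [c|]] ac]; apply: val_inj; rewrite /= ?alK' ?beK'.
have Fadj (x y : G) : adj (F x) (F y) = adj x y.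
  rewrite /= /ball_adj /cart_adj /=.
  rewrite !(inj_eq (inj_omap (can_inj alK))) !(inj_eq (inj_omap (can_inj beK))).
  by rewrite /star_adj; case: x y => [[[?|] [?|]] ?] [[[?|] [?|]] ?].
by exists (Symmetry FK FK' Fadj).
Qed.

End BallAut.

(** * A rigid incidence structure with prescribed automorphism group *)

Local Open Scope classical_set_scope.

Definition strict_wo (T : Type) (lt : rel T) : Prop :=
  [/\ irreflexive lt, forall x y, x <> y -> lt y x = ~~ lt x y &
    forall P : T -> Prop, (exists x, P x) ->
      exists2 m, P m & forall x, P x -> ~~ lt x m].

Lemma strict_wo_exists (T : choiceType) : exists lt : rel T, strict_wo lt.
Proof.
have [le wo] := wochoice.well_ordering_principle T.
have woT : wochoice.wo_chain le (mem predT) by apply: wochoice.withinW.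
have tot x y : le x y || le y x by apply: (wochoice.wo_chainW woT); rewrite inE.
have anti : antisymmetric le.
  by move=> x y; apply: (wochoice.wo_chain_antisymmetric woT); rewrite inE.
exists (fun x y => (x != y) && le x y); split=> [x|x y xy|P [x Px]].
- by rewrite eqxx.
- have {}xy : x != y by exact/eqP.
  rewrite xy eq_sym xy /=; have := tot x y; case: (boolP (le x y)) => //= xley _.
  by apply: contraNF xy => yx; apply/eqP/anti/andP.
- have [|m [[Pm lb] _]] := wo (fun x => `[< P x >]); first by exists x; apply/asboolP.
  exists m; first exact/asboolP.
  move=> y Py; rewrite negb_and negbK; case: (eqVneq y m) => //= ym.
  apply: contraNN ym => le1; apply/eqP/anti; rewrite le1 lb //.
  exact/asboolP.
Qed.

(** Otherwise [x], [y], [z] form a directed cycle, a set without minimal element. *)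
Lemma strict_wo_trans (T : Type) (lt : rel T) : strict_wo lt -> transitive lt.
Proof.
move=> [irr tour wf] y x z xy yz; apply: contrapT => /negP nxz.
have xz : x <> z.
  move=> E; have yx : y <> x by move=> E'; move: xy; rewrite E' irr.
  by move: yz; rewrite -E tour ?xy // => E'; apply: yx.
have zx : lt z x by rewrite tour.
have [|m + min] := wf (fun w => [\/ w = x, w = y | w = z]).
  by exists x; constructor 1.
have hx := min x (Or31 _ _ erefl); have hy := min y (Or32 _ _ erefl).
have hz := min z (Or33 _ _ erefl).
by case=> E; move: hx hy hz; rewrite E ?xy ?yz ?zx.
Qed.

(** Take the least moved element [m]. An image or a preimage of [m] below [m] would be fixed, so
    both lie above [m]; but applying [pi] to [m < pi' m] gives [pi m < m]. *)
Lemma strict_wo_rigid (T : Type) (lt : rel T) (pi pi' : T -> T) :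
  strict_wo lt -> cancel pi pi' -> cancel pi' pi ->
  (forall x y, lt (pi x) (pi y) = lt x y) -> forall x, pi x = x.
Proof.
move=> [irr tour wf] K K' mon.
have [//|/existsNP/wf[m nm min]] := pselect (forall x, pi x = x).
have fixlt x : lt x m -> pi x = x.
  by move=> xm; apply: contrapT => /min; rewrite xm.
case: (boolP (lt (pi m) m)) => [/fixlt/(can_inj K)//|].
rewrite -tour; last exact: nm.
move=> m_lt; exfalso; case: (boolP (lt (pi' m) m)) => [/fixlt|].
  by rewrite K' => E; apply: nm; rewrite E K'.
rewrite -tour; last by move=> E; apply: nm; rewrite -{1}E K'.
by rewrite -mon K' tour ?m_lt//; apply: nesym.
Qed.


Lemma finite_option (T : Type) : finite_set [set: T] -> finite_set [set: option T].
Proof.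
move=> fT; apply: (@sub_finite_set _ _ ([set None] `|` Some @` [set: T])).
  by move=> [t|] _; [right; exists t|left].
by rewrite finite_setU; split; [exact: finite_set1|exact: finite_image].
Qed.

Lemma finite_ball_graph (A C : choiceType) (r : A -> C -> bool) :
  finite_set [set: A] -> finite_set [set: C] -> finite_graph (ball_graph r).
Proof.
move=> fA fC; apply: (@sub_finite_set _ _
  ((fun u => insubd (cone r : ball_vertex r) u) @` ([set: option A] `*` [set: option C]))).
  by move=> x _; exists (val x) => //; exact: valKd.
by apply/finite_image/finite_setX; exact: finite_option.
Qed.

Section Construction.
Variables (Gamma : groupType) (lt : rel Gamma).
Hypothesis lt_wo : strict_wo lt.

(** The points [Arc g h] are the arcs of the complete Cayley graph, loops included, with colour
    [g^-1 * h]. The maps of [Gamma] that preserve all colours are exactly the left translations. The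
    other points are markers. *)
Inductive point := Arc of Gamma & Gamma | X0 | X1 | Z.
Inductive block := Omega | Row of Gamma | Col of Gamma | Chain of option Gamma.

HB.instance Definition _ := gen_eqMixin point.
HB.instance Definition _ := gen_choiceMixin point.
HB.instance Definition _ := gen_eqMixin block.
HB.instance Definition _ := gen_choiceMixin block.

(* The only proper inclusion between neighbourhoods of points is that of Z in
   X0. Hence an automorphism fixes Z and X0, so it preserves the chains (the
   blocks on Z other than Omega), the rows (the remaining blocks on X0) and the
   columns. It fixes every chain because chains are well-ordered by inclusion,
   and the chains through Arc g h determine the colour g^-1 * h. *)
Definition frucht_inc (p : point) (b : block) : bool :=
  match b, p with
  | Omega, _ | Row _, X0 | Col _, X1 | Chain None, X0 | Chain None, Z
  | Chain (Some _), X0 | Chain (Some _), X1 | Chain (Some _), Z => true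
  | Row g, Arc g' _ => g' == g
  | Col h, Arc _ h' => h' == h
  | Chain (Some t), Arc g h => lt (g^-1 * h)%g t
  | _, _ => false
  end.

Lemma inc_point a c : exists2 c', c' != c & frucht_inc a c'.
Proof.
have [c' c'O ac'] : exists2 c', c' != Omega & frucht_inc a c'.
  case: a => [g h|||]; [exists (Row g)|exists (Row 1%g)|exists (Col 1%g)|
    exists (Chain None)]; rewrite //= ?eqxx //; exact/eqP.
case: (eqVneq c Omega) => [->|nc]; first by exists c'.
by exists Omega; rewrite // eq_sym.
Qed.

Lemma inc_block c a : exists2 a', a' != a & frucht_inc a' c.
Proof.
have [u [v [uv uc vc]]] : exists u v, [/\ u != v, frucht_inc u c & frucht_inc v c].
  case: c => [|g|h|i].
  - by exists X0, X1; split=> //; exact/eqP.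
  - by exists X0, (Arc g 1%g); split=> //=; exact/eqP.
  - by exists X1, (Arc 1%g h); split=> //=; exact/eqP.
  - by exists X0, Z; split; [exact/eqP|case: i|case: i].
by case: (eqVneq u a) => [<-|ua]; [exists v; rewrite // eq_sym|exists u].
Qed.

Lemma inc_not_full a : exists c, ~~ frucht_inc a c.
Proof.
by case: a => [g h|||]; [exists (Chain None)|exists (Col 1%g)|exists (Chain None)|
  exists (Row 1%g)].
Qed.

Lemma block_full c : (forall a, frucht_inc a c) -> c = Omega.
Proof.
case: c => [//|g|h|[t|]] full; [have := full Z|have := full Z| |have := full X1] => //.
(* The arc from 1 to [t] has colour [t], which is not below [t]; so it is not on the chain at
   [t]. *)
have := full (Arc 1%g t); rewrite /= invg1 mul1g.
by case: lt_wo => ->.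
Qed.

Lemma point_dominated a b : a <> b -> (forall c, frucht_inc a c -> frucht_inc b c) ->
  a = Z /\ b = X0.
Proof.
case: a b => [g h|||] [g' h'|||] // ab dom; exfalso.
- have /eqP g'g := dom (Row g) (eqxx _); have /eqP h'h := dom (Col h) (eqxx _).
  by apply: ab; rewrite g'g h'h.
- by have := dom (Col h) (eqxx _).
- by have := dom (Row g) (eqxx _).
- by have := dom (Row g) (eqxx _).
- by have := dom (Chain None) isT.
- by have := dom (Row 1%g) isT.
- by have := dom (Row 1%g) isT.
(* The chain at the colour of an arc misses that arc but contains [X1]. *)
- have := dom (Chain (Some (g'^-1 * h')%g)) isT.
  by case: lt_wo => /= ->.
- by have := dom (Col 1%g) isT.
- by have := dom (Col 1%g) isT.
- by have := dom (Chain None) isT.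
- by have := dom (Chain None) isT.
Qed.

Lemma dominated_Z c : frucht_inc Z c -> frucht_inc X0 c.
Proof. by case: c => [|g|h|[]]. Qed.

Lemma inc_Z c : frucht_inc Z c -> c = Omega \/ exists i, c = Chain i.
Proof. by case: c => [|g|h|i] // _; [left|right; exists i]. Qed.

Lemma inc_X0 c : frucht_inc X0 c -> ~~ frucht_inc Z c -> exists g, c = Row g.
Proof. by case: c => [|g|h|[]] // _ _; exists g. Qed.

Lemma not_inc_X0 c : ~~ frucht_inc X0 c -> exists h, c = Col h.
Proof. by case: c => [|g|h|[]] // _; exists h. Qed.

Section Rigidity.
Variables (al al' : point -> point) (be be' : block -> block).
Hypotheses (alK : cancel al al') (alK' : cancel al' al).
Hypotheses (beK : cancel be be') (beK' : cancel be' be).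
Hypothesis incM : forall a c, frucht_inc (al a) (be c) = frucht_inc a c.

Lemma al_special : al Z = Z /\ al X0 = X0.
Proof.
apply: point_dominated; first by move/(can_inj alK).
by move=> c; rewrite -(beK' c) !incM; exact: dominated_Z.
Qed.

Lemma be_Omega : be Omega = Omega.
Proof. by apply: block_full => a; rewrite -(alK' a) incM. Qed.

Lemma be_chain : exists pi : option Gamma -> option Gamma,
  forall i, be (Chain i) = Chain (pi i).
Proof.
suff h i : exists j, be (Chain i) = Chain j.
  by have [pi] := choice h; exists pi.
have : frucht_inc Z (be (Chain i)) by rewrite -al_special.1 incM; case: i.
case/inc_Z => // E; have : be (Chain i) = be Omega by rewrite E be_Omega.
by move/(can_inj beK).
Qed.

Lemma be_row : exists sg : Gamma -> Gamma, forall g, be (Row g) = Row (sg g).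
Proof.
have h g : exists g', be (Row g) = Row g'.
  by apply: inc_X0; [rewrite -al_special.2 incM|rewrite -al_special.1 incM].
by have [sg] := choice h; exists sg.
Qed.

Lemma be_col : exists sg : Gamma -> Gamma, forall g, be (Col g) = Col (sg g).
Proof.
have h g : exists g', be (Col g) = Col g'.
  by apply: not_inc_X0; rewrite -al_special.2 incM.
by have [sg] := choice h; exists sg.
Qed.

End Rigidity.

Section Colour.
Variables (al al' : point -> point) (be be' : block -> block).
Hypotheses (alK : cancel al al') (alK' : cancel al' al).
Hypotheses (beK : cancel be be') (beK' : cancel be' be).
Hypothesis incM : forall a c, frucht_inc (al a) (be c) = frucht_inc a c.

Lemma incM' a c : frucht_inc (al' a) (be' c) = frucht_inc a c.
Proof. by rewrite -incM alK' beK'. Qed.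

Lemma be_chain_id i : be (Chain i) = Chain i.
Proof.
have [pi piE] := be_chain alK alK' beK beK' incM.
have [pi' piE'] := be_chain alK' alK beK' beK incM'.
have K : cancel pi pi' by move=> j; have := beK (Chain j); rewrite piE piE' => -[].
have K' : cancel pi' pi by move=> j; have := beK' (Chain j); rewrite piE' piE => -[].
(* Inclusion of the point sets of two chains, a relation that [be] preserves in both directions. *)
pose sub j k := forall a, frucht_inc a (Chain j) -> frucht_inc a (Chain k).
have subM j k : sub j k -> sub (pi j) (pi k).
  by move=> jk a; rewrite -!piE -(alK' a) !incM; exact: jk.
(* [Chain None] is contained in every chain, hence so is its image. An image [Chain (Some t)] would
   then put [X1] on [Chain None]. *)
have piN : pi None = None.
  case E : (pi None) => [t|//]; have : sub (pi None) (pi (pi' None)).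
    by apply: subM; case: (pi' None) => [s|] // -[].
  by rewrite E K' => /(_ X1 isT).
have [rho rhoE] : exists rho, forall t, pi (Some t) = Some (rho t).
  suff h t : exists s, pi (Some t) = Some s by by have [sg] := choice h; exists sg.
  case E : (pi (Some t)) => [s|]; first by exists s.
  by have := K (Some t); rewrite E -{1}piN K.
have [rho' rhoE'] : exists rho, forall t, pi' (Some t) = Some (rho t).
  suff h t : exists s, pi' (Some t) = Some s by by have [sg] := choice h; exists sg.
  case E : (pi' (Some t)) => [s|]; first by exists s.
  by have := K' (Some t); rewrite E piN.
have rK : cancel rho rho' by move=> t; have := K (Some t); rewrite rhoE rhoE' => -[].
have rK' : cancel rho' rho by move=> t; have := K' (Some t); rewrite rhoE' rhoE => -[].
(* If [t] is below [s], the arc from 1 to [t] is on the chain at [s] but not on the one at [t]. *)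
have subE s t : sub (Some s) (Some t) <-> ~~ lt t s.
  case: (lt_wo) => irr tour _; split=> [h|ts [g h|||] //=].
    apply/negP => ts; have := h (Arc 1%g t).
    by rewrite /= invg1 mul1g irr ts => /(_ isT).
  move=> cs; have [<-//|/eqP st] := eqVneq s t.
  by apply: (strict_wo_trans lt_wo cs); rewrite tour //; exact: nesym.
have subM' j k : sub (pi j) (pi k) -> sub j k.
  by move=> jk a; rewrite -(incM a (Chain j)) -(incM a (Chain k)) !piE; exact: jk.
case: i => [t|]; rewrite piE ?piN // rhoE; congr (Chain (Some _)).
apply: (strict_wo_rigid lt_wo rK rK') => x y; apply: negb_inj.
by apply/idP/idP => /subE h; apply/subE; [apply: subM'; rewrite !rhoE|
  rewrite -!rhoE; exact: subM].
Qed.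

(** The rows and columns through an arc give its tail and head, so [al] acts on arcs by a
    permutation [sg] of tails and [ta] of heads. Colours are kept because chains are fixed. Loops
    then yield [ta = sg], and the arcs leaving 1 yield that [sg] is the left translation by
    [sg 1]. *)
Lemma translation : exists g0,
  [/\ forall g h, al (Arc g h) = Arc (g0 * g)%g (g0 * h)%g,
      al X0 = X0, al X1 = X1, al Z = Z &
    [/\ be Omega = Omega, forall i, be (Chain i) = Chain i,
      forall g, be (Row g) = Row (g0 * g)%g &
      forall g, be (Col g) = Col (g0 * g)%g]].
Proof.
have [alZ alX0] := al_special alK beK' incM.
have beO := be_Omega alK' incM.
have [sg sgE] := be_row alK beK' incM.
have [ta taE] := be_col alK beK' incM.
have alE g h : al (Arc g h) = Arc (sg g) (ta h).
  have := incM (Arc g h) (Row g); have := incM (Arc g h) (Col h).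
  rewrite sgE taE /= !eqxx.
  by case: (al (Arc g h)) => //= g' h' /eqP -> /eqP ->.
have color g h : ((sg g)^-1 * ta h = g^-1 * h)%g.
  (* Each of two different colours would have to be not below the other, since it is not below
     itself. *)
  have same t : lt ((sg g)^-1 * ta h)%g t = lt (g^-1 * h)%g t.
    by have := incM (Arc g h) (Chain (Some t)); rewrite alE be_chain_id.
  case: (lt_wo) => irr tour _; apply: contrapT => ne.
  have := tour _ _ ne; rewrite same irr -same irr.
  by [].
have tasg g : ta g = sg g.
  by have := color g g; rewrite mulVg => /(congr1 (fun u => (sg g * u)%g)); rewrite mulVKg mulg1.
have sgT g : sg g = (sg 1 * g)%g.
  have := color 1%g g; rewrite invg1 mul1g tasg => /(congr1 (fun u => (sg 1 * u)%g)).
  by rewrite mulVKg.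
exists (sg 1%g); split=> //.
- by move=> g h; rewrite alE tasg -!sgT.
(* [al X1] lies on a column, as only arcs and [X1] do, and on every [Chain (Some t)], as no arc
   does. *)
- have h1 := incM X1 (Col 1%g); rewrite taE in h1.
  have h2 t : frucht_inc (al X1) (Chain (Some t)) by rewrite -be_chain_id incM.
  case E : (al X1) h1 h2 => [g h|||] //= _ h2.
  by have := h2 (g^-1 * h)%g; case: (lt_wo) => ->.
- split=> // g; [exact: be_chain_id|by rewrite sgE -sgT|by rewrite taE tasg -sgT].
Qed.

End Colour.

Definition frucht_graph : sgraph := ball_graph frucht_inc.

Lemma inc_Omega a : frucht_inc a Omega.
Proof. by case: a. Qed.

Definition tr_point (g0 : Gamma) (p : point) : point :=
  if p is Arc g h then Arc (g0 * g)%g (g0 * h)%g else p.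

Definition tr_block (g0 : Gamma) (b : block) : block :=
  match b with
  | Row g => Row (g0 * g)%g
  | Col g => Col (g0 * g)%g
  | _ => b
  end.

Lemma tr_inc g0 a c : frucht_inc (tr_point g0 a) (tr_block g0 c) = frucht_inc a c.
Proof.
case: a c => [g h|||] [|g'|h'|[t|]] //=; rewrite ?(inj_eq (mulgI _)) //.
by rewrite invgM -mulgA mulKg.
Qed.

Lemma tr_pointM g h : tr_point (g * h)%g =1 tr_point g \o tr_point h.
Proof. by case=> [u v|||] //=; rewrite !mulgA. Qed.

Lemma tr_blockM g h : tr_block (g * h)%g =1 tr_block g \o tr_block h.
Proof. by case=> [|u|u|u] //=; rewrite !mulgA. Qed.

Lemma tr_pointK g : cancel (tr_point g) (tr_point g^-1%g).
Proof. by case=> [u v|||] //=; rewrite !mulKg. Qed.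

Lemma tr_blockK g : cancel (tr_block g) (tr_block g^-1%g).
Proof. by case=> [|u|u|u] //=; rewrite !mulKg. Qed.

Lemma frucht : group_isomorphic Gamma (aut frucht_graph).
Proof.
have trE g : exists f : aut frucht_graph, forall x,
    val (f x) = (omap (tr_point g) (val x).1, omap (tr_block g) (val x).2).
  apply: (incidence_aut_exists (@tr_pointK g) _ (@tr_blockK g) _ (@tr_inc g)).
  - by have := @tr_pointK g^-1%g; rewrite invgK.
  - by have := @tr_blockK g^-1%g; rewrite invgK.
have [F FE] := choice trE.
apply: (@bijective_group_isomorphic _ _ F).
  move=> g h; apply: symmetry_ext => x; apply: val_inj; rewrite FE /= !FE /=.
  by case: x => [[[a|] [c|]] ?] /=; rewrite ?tr_pointM ?tr_blockM.
have Finj : injective F.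
  move=> g h gh; have := FE g (rvert frucht_inc (Row 1%g)).
  by rewrite gh FE /= !mulg1 => -[].
have Fsurj f : exists g, F g = f.
  have [al [be [[al' alK alK'] [be' beK beK'] fl fr incM]]] :=
    aut_sides inc_point inc_block X0 inc_Omega f inc_not_full.
  have [g0 [hA h0 h1 hZ [hO hC hR hL]]] := translation alK alK' beK beK' incM.
  exists g0; apply: (aut_eq inc_point inc_block Omega X0).
    move=> a; rewrite [RHS]fl; apply: val_inj; rewrite [LHS]FE /=.
    by case: a => [g h|||] /=; rewrite ?hA ?h0 ?h1 ?hZ.
  move=> c; rewrite [RHS]fr; apply: val_inj; rewrite [LHS]FE /=.
  by case: c => [|g|h|i] /=; rewrite ?hO ?hC ?hR ?hL.
have [Fi FiE] := choice Fsurj.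
by exists Fi => // x; apply: Finj; rewrite FiE.
Qed.

Lemma frucht_finite : finite_set [set: Gamma] -> finite_graph frucht_graph.
Proof.
move=> fG; apply: finite_ball_graph.
  apply: (@sub_finite_set _ _ ([set X0; X1; Z] `|`
    (fun u => Arc u.1 u.2) @` ([set: Gamma] `*` [set: Gamma]))).
    by move=> [g h|||] _; [right; exists (g, h)|left; left; left|left; left; right|left; right].
  by rewrite finite_setU; split; [exact: finite_set3|exact/finite_image/finite_setX].
apply: (@sub_finite_set _ _ ([set Omega] `|` (Row @` setT `|` (Col @` setT `|`
  Chain @` setT)))).
  by move=> [|g|h|i] _; [left|right; left; exists g|right; right; left; exists h|
    right; right; right; exists i].
rewrite !finite_setU; do ! split; [exact: finite_set1|exact: finite_image|
  exact: finite_image|exact/finite_image/finite_option].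
Qed.

End Construction.

Section Geometry.

Local Open Scope ring_scope.

(** * Stars as finite dendrons *)

Section StarDef.
Variables (R : realType) (A : choiceType).

(** The centre is the only point without an arm, and radius 0 is forbidden on the arms. Thus each
    point has one representation and no quotient is required. *)
Record star := Star {
  sarm : option A;
  srad : R;
  star_ok : if sarm is Some _ then 0 < srad <= 1 else srad == 0
}.

HB.instance Definition _ := gen_eqMixin star.
HB.instance Definition _ := gen_choiceMixin star.

Definition center : star := @Star None 0 (eqxx 0).

HB.instance Definition _ := isPointed.Build star center.

(** Total in [s], with the centre as default value; in particular all arms start at the same point
    [spt a 0]. *)
Definition spt (a : A) (s : R) : star :=
  if pselect (0 < s <= 1) is left h then @Star (Some a) s h else center.

Definition sdist (x y : star) : R :=
  if sarm x == sarm y then `|srad x - srad y| else srad x + srad y.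

Lemma star_eq (x y : star) : sarm x = sarm y -> srad x = srad y -> x = y.
Proof.
case: x y => [a s h] [b t k] /= ab st; move: h k; rewrite ab st => h k.
by congr Star; exact: Prop_irrelevance.
Qed.

Lemma spt0 a : spt a 0 = center.
Proof.
rewrite /spt; case: pselect => //.
by move=> h; exfalso; move: h; rewrite ltxx.
Qed.

Lemma arm_spt a s : 0 < s <= 1 -> sarm (spt a s) = Some a.
Proof. by rewrite /spt; case: pselect. Qed.

Lemma rad_spt a s : 0 <= s <= 1 -> srad (spt a s) = s.
Proof.
rewrite /spt; case: pselect => // h /andP[s0 s1].
move/negP: h; rewrite s1 andbT -leNgt => s0'; apply/eqP.
by rewrite eq_le s0 s0'.
Qed.

Lemma sptP (a0 : A) (x : star) : exists a s, 0 <= s <= 1 /\ x = spt a s.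
Proof.
case: x => [[a|] s h].
  have /andP[s0 s1] := h; exists a, s; rewrite (ltW s0) s1; split=> //.
  by apply: star_eq; rewrite ?arm_spt ?rad_spt //= (ltW s0).
exists a0, 0; rewrite lexx ler01; split=> //; rewrite spt0.
by apply: star_eq => //=; apply/eqP.
Qed.

Lemma sdist_spt a s b t : 0 <= s <= 1 -> 0 <= t <= 1 ->
  sdist (spt a s) (spt b t) = if a == b then `|s - t| else s + t.
Proof.
move=> hs ht; rewrite /sdist !rad_spt//.
have armE c u : 0 <= u <= 1 -> sarm (spt c u) = if u == 0 then None else Some c.
  move=> /andP[u0 u1]; case: eqP => [->|/eqP nu]; first by rewrite spt0.
  by rewrite arm_spt // lt_neqAle eq_sym nu u0.
rewrite !armE//; move: hs ht => /andP[s0 _] /andP[t0 _].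
case: (eqVneq s 0) => [->|ns]; case: (eqVneq t 0) => [->|nt] /=.
- by rewrite subrr addr0 normr0 if_same.
- by rewrite sub0r add0r normrN ger0_norm // if_same.
- by rewrite subr0 addr0 ger0_norm // if_same.
- by rewrite (inj_eq (@Some_inj _)).
Qed.

Fact sdistxx x : sdist x x = 0.
Proof. by rewrite /sdist eqxx subrr normr0. Qed.

Fact sdist_eq0 x y : sdist x y = 0 -> x = y.
Proof.
rewrite /sdist; case: eqP => [xy /normr0_eq0/eqP|xy].
  by rewrite subr_eq0 => /eqP; exact: star_eq.
case: x y xy => [[a|] s h] [[b|] t k] //= ab st; exfalso; move: h k; clear ab.
- by move=> /andP[? _] /andP[? _]; lra.
- by move=> /andP[? _] /eqP ?; lra.
- by move=> /eqP ? /andP[? _]; lra.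
Qed.

Fact sdist_sym x y : sdist x y = sdist y x.
Proof. by rewrite /sdist eq_sym distrC [srad x + _]addrC. Qed.

Fact rad_ge0 x : 0 <= srad x.
Proof. by case: x => [[a|] s] /= h; [case/andP: h => /ltW|rewrite (eqP h)]. Qed.

Fact sdist_triangle y x z : sdist x z <= sdist x y + sdist y z.
Proof.
rewrite /sdist; have := rad_ge0 x; have := rad_ge0 y; have := rad_ge0 z.
case: (eqVneq (sarm x) (sarm y)) => [->|xy]; last first.
  case: (eqVneq (sarm x) (sarm z)) => [<-|xz].
    by rewrite eq_sym (negPf xy) => *; case: ger0P => *; lra.
  by case: (eqVneq (sarm y) (sarm z)) => _ *; do ?case: ger0P => *; lra.
by case: (eqVneq (sarm y) (sarm z)) => _ *; do ?case: ger0P => *; lra.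
Qed.

HB.instance Definition _ :=
  isMetric.Build R star sdistxx sdist_eq0 sdist_sym sdist_triangle.

Lemma mdistE (x y : star) : mdist x y = sdist x y.
Proof. by []. Qed.

End StarDef.

Lemma lipschitz_within (R : realType) (U V : pseudoMetricType R) (D : set U)
    (f : U -> V) (k : R) : 0 < k ->
  (forall x y e, D x -> D y -> ball x e y -> ball (f x) (k * e) (f y)) ->
  {within D, continuous f}.
Proof.
move=> k0 h; apply/subspace_continuousP => x Dx; apply/cvg_ballP => e e0.
rewrite near_withinE; near=> y => Dy.
have : ball x (e / k) y by near: y; apply: near_ball; rewrite divr_gt0.
by move/(h _ _ _ Dx Dy); rewrite mulrC divfK // gt_eqF.
Unshelve. all: by end_near. Qed.

Lemma lipschitz_continuous (R : realType) (U V : pseudoMetricType R)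
    (f : U -> V) (k : R) : 0 < k ->
  (forall x y e, ball x e y -> ball (f x) (k * e) (f y)) -> continuous f.
Proof.
move=> k0 h x; apply/cvg_ballP => e e0; near=> y.
have : ball x (e / k) y by near: y; apply: near_ball; rewrite divr_gt0.
by move/h; rewrite mulrC divfK // gt_eqF.
Unshelve. all: by end_near. Qed.

Ltac by_order := solve [assumption | apply: ltW; assumption | exact: lexx].

Ltac norm_lra :=
  repeat match goal with
  | |- context [ @Num.norm _ _ (?x - ?y) ] =>
    first
      [ have -> : `|x - y| = x - y by apply: ger0_norm; rewrite subr_ge0; by_order
      | have -> : `|x - y| = y - x
          by rewrite distrC; apply: ger0_norm; rewrite subr_ge0; by_order
      | case: (ger0P (x - y)) => ? ]
  | |- context [ @Num.norm _ _ ?x ] => case: (ger0P x) => ?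
  end; lra.

(** * Arcs, leaves and ramification points of a star *)

Section StarTheory.
Variables (R : realType) (A : choiceType) (a0 : A).
Local Notation star := (star R A).
Implicit Types (x y z w : star) (a b c : A) (s t r : R).

Definition crd b x : R := if sarm x == Some b then srad x else 0.

Lemma rad_le1 x : srad x <= 1.
Proof. by case: x => [[a|] s] /= h; [case/andP: h|rewrite (eqP h)]. Qed.

Lemma crd_spt b a s : 0 <= s <= 1 -> crd b (spt a s) = if a == b then s else 0.
Proof.
move=> hs; rewrite /crd rad_spt //; case: (eqVneq s 0) => [->|ns].
  by rewrite !if_same.
rewrite arm_spt ?(inj_eq (@Some_inj _)) //.
by move: hs => /andP[s0 ->]; rewrite lt_neqAle eq_sym ns s0.
Qed.

Lemma crd_lip b x y : `|crd b x - crd b y| <= sdist x y.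
Proof.
have [a [s [hs ->]]] := sptP a0 x; have [c [t [ht ->]]] := sptP a0 y.
rewrite !crd_spt// sdist_spt//; move: hs ht => /andP[s0 s1] /andP[t0 t1].
case: (eqVneq a c) => [->|ac]; first by case: ifP; rewrite // subrr normr0.
case: (eqVneq a b) => [ab|ab]; case: (eqVneq c b) => [cb|cb].
- by move: ac; rewrite ab cb eqxx.
- by clear ac ab cb; case: ger0P => *; lra.
- by clear ac ab cb; case: ger0P => *; lra.
- by clear ac ab cb; case: ger0P => *; lra.
Qed.

Lemma rad_lip x y : `|srad x - srad y| <= sdist x y.
Proof.
rewrite /sdist; have := rad_ge0 x; have := rad_ge0 y.
by case: ifP => _ *; case: ger0P => *; lra.
Qed.

Lemma lip_continuous (h : star -> R) k : 0 < k ->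
  (forall x y, `|h x - h y| <= k * sdist x y) -> continuous h.
Proof.
move=> k0 hl; apply: (lipschitz_continuous k0) => x y e.
rewrite ballEmdist /= => xy; rewrite /ball /=.
by apply: le_lt_trans (hl x y) _; rewrite ltr_pM2l.
Qed.

Definition between x y z := sdist x z + sdist z y = sdist x y.

Lemma crd_eq b x r : 0 < r -> crd b x = r -> x = spt b r.
Proof.
have [a [s [hs ->]]] := sptP a0 x => r0; rewrite crd_spt //.
case: eqP => [->|_] E; last by rewrite E ltxx in r0.
by rewrite E.
Qed.

(* By the intermediate value theorem, every path from x to y passes through z. *)
Lemma separation x y z : between x y z -> z <> x -> z <> y ->
  exists (h : star -> R), [/\ forall u v, `|h u - h v| <= 3 * sdist u v,
    h y <= 0 <= h x \/ h x <= 0 <= h y & forall u, h u = 0 -> u = z].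
Proof.
have [a [s [hs ->]]] := sptP a0 x; have [b [t [ht ->]]] := sptP a0 y.
have [c [r [hr ->]]] := sptP a0 z.
have [r0|r0] := ltP 0 r; last first.
  have -> : r = 0 by move: hr => /andP[? _]; lra.
  rewrite /between (spt0 R c) -{1}(spt0 R a) -{1}(spt0 R b) !sdist_spt ?lexx ?ler01//.
  rewrite !eqxx; move: (hs) (ht) => /andP[s0 s1] /andP[t0 t1] E nx ny.
  have {}s0 : 0 < s.
    by rewrite lt_neqAle s0 andbT; apply/eqP => s00; apply: nx; rewrite -s00 spt0.
  have {}t0 : 0 < t.
    by rewrite lt_neqAle t0 andbT; apply/eqP => t00; apply: ny; rewrite -t00 spt0.
  have ab : a != b.
    apply/eqP => ab; move: E; rewrite ab eqxx; clear ab nx ny.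
    by do 3?case: ger0P => ?; lra.
  (* The signed distance from the centre, positive on the arm of [x] and negative on all others. The
     Lipschitz constant 3 is the crude bound 2 + 1. *)
  exists (fun u => 2 * crd a u - srad u); split.
  - move=> u v; have := crd_lip a u v; have := rad_lip u v.
    clear; by do 3?case: ger0P => ?; move=> *; lra.
  - by left; rewrite !crd_spt// !rad_spt// eqxx eq_sym (negPf ab); lra.
  - move=> u; have [d [q [hq ->]]] := sptP a0 u; rewrite crd_spt// rad_spt//.
    move=> h; have q0 : q = 0 by case: ifP h => *; lra.
    by rewrite q0 spt0.
(* For [r > 0] the level set [crd c = r] is the single point [z]. *)
rewrite /between => E nx ny; exists (fun u => crd c u - r); split.
- move=> u v; have := crd_lip c u v.
  clear; by do 3?case: ger0P => ?; move=> *; lra.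
- move: E; rewrite !sdist_spt// !crd_spt//.
  move: hs ht hr => /andP[s0 s1] /andP[t0 t1] /andP[_ r1].
  case: (eqVneq a c) => [E|ac]; [subst a|]; case: (eqVneq b c) => [E|bc]; [subst b| |subst b|];
  rewrite ?eqxx ?(eq_sym c) ?(negPf ac) ?(negPf bc); clear nx ny.
  + case: (lerP s r) => sr; case: (lerP r t) => rt E.
    * by right; apply/andP; split; lra.
    * by left; apply/andP; split; move: E; norm_lra.
    * by left; apply/andP; split; move: E; norm_lra.
    * by left; apply/andP; split; lra.
  + by case: (ger0P (s - r)) => ? E; left; apply/andP; split; lra.
  + by case: (ger0P (r - t)) => ? E; right; apply/andP; split; lra.
  + by case: ifP => _; [case: (ger0P (s - t)) => ?|]; move=> E; left; apply/andP; split; lra.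
- move=> u /eqP; rewrite subr_eq0 => /eqP; exact: crd_eq.
Qed.

Ltac solve_main :=
  by [apply/andP; split; lra|move=> ?; lra|norm_lra|norm_lra].


Lemma path_between (g : R -> star) (p q : R) z :
  {within `[0, 1], continuous g} -> 0 <= p -> p <= q -> q <= 1 ->
  between (g p) (g q) z -> exists2 t, p <= t <= q & g t = z.
Proof.
move=> gc p0 pq q1 zb.
have [->|zp] := pselect (z = g p); first by exists p; rewrite ?lexx.
have [->|zq] := pselect (z = g q); first by exists q; rewrite ?lexx ?pq.
have [h [hlip hpq hz]] := separation zb zp zq.
have hc : continuous h by apply: (lip_continuous _ hlip).
have hgc : {within `[p, q], continuous (h \o g)}.
  apply: (@continuous_subspaceW _ _ `[p, q]%classic `[0, 1]%classic).
    move=> t /=; rewrite !in_itv /= => /andP[pt tq].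
    by rewrite (le_trans p0) // (le_trans tq).
  move/subspace_continuousP: gc => gc'; apply/subspace_continuousP => t t01.
  exact: (cvg_comp _ _ (gc' t t01) (hc (g t))).
have [|t tpq ht] := @IVT R (h \o g) p q 0 pq hgc.
  rewrite /= ge_min le_max.
  by case: hpq => /andP[-> ->]; rewrite ?orbT.
by exists t; [move: tpq; rewrite in_itv|exact: hz].
Qed.

(** [m] is the median of [x], [y], [w], where the way from [w] meets the geodesic from [x] to [y]. A
    path from [x] to [y] that visits [w] passes through [m] both before and after. *)
Lemma detour x y w : ~ between x y w ->
  exists m, [/\ m <> w, between x w m & between w y m].
Proof.
have [a [s [hs ->]]] := sptP a0 x; have [b [t [ht ->]]] := sptP a0 y.
have [c [r [hr ->]]] := sptP a0 w.
have neq d q q' : 0 <= q <= 1 -> 0 <= q' <= 1 -> q != q' -> spt d q <> spt d q' :> star.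
  move=> hq hq' nq E; have := sdist_spt d d hq hq'.
  by rewrite E sdistxx eqxx => /esym/normr0P; rewrite subr_eq0 (negPf nq).
have main : forall d q, 0 <= q <= 1 -> c = d -> q != r ->
    (if a == d then `|s - q| else s + q) + `|q - r| = (if a == d then `|s - r| else s + r) ->
    `|r - q| + (if d == b then `|q - t| else q + t) = (if d == b then `|r - t| else r + t) ->
    exists m, [/\ m <> spt c r :> star, between (spt a s) (spt c r) m & between (spt c r) (spt b t) m].
  move=> d q hq -> qr h1 h2; exists (spt d q); split; first exact: neq.
    by rewrite /between !sdist_spt // eqxx h1.
  by rewrite /between !sdist_spt // eqxx h2.
move=> nb; have {}nb : (if a == c then `|s - r| else s + r) + (if c == b then `|r - t| else r + t)
    <> (if a == b then `|s - t| else s + t).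
  by move=> E; apply: nb; rewrite /between !sdist_spt.
move: (hs) (ht) (hr) => /andP[s0 s1] /andP[t0 t1] /andP[r0 r1].
have [r00|rn0] := eqVneq r 0.
  have ab : a = b.
    apply/eqP; apply: contra_notT nb => nab; rewrite r00 subr0 sub0r normrN !addr0 !add0r.
    by rewrite (ger0_norm s0) (ger0_norm t0) !if_same (negPf nab).
  subst b r; move: nb; rewrite eqxx subr0 sub0r normrN !addr0 !add0r (ger0_norm s0) (ger0_norm t0) !if_same => nb.
  have E : spt c 0 = spt a 0 :> star by rewrite !spt0.
  rewrite E; clear main; have [st|ts] := lerP s t.
    have sn0 : s != 0 by apply: contra_notN nb => /eqP s00; norm_lra.
    exists (spt a s); split; first exact: neq.
      by rewrite /between !sdist_spt // eqxx; clear nb; norm_lra.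
    by rewrite /between !sdist_spt // eqxx; clear nb; norm_lra.
  have tn0 : t != 0 by apply: contra_notN nb => /eqP t00; norm_lra.
  exists (spt a t); split; first exact: neq.
    by rewrite /between !sdist_spt // eqxx; clear nb; norm_lra.
  by rewrite /between !sdist_spt // eqxx; clear nb; norm_lra.
have {rn0}r0 : 0 < r by rewrite lt_neqAle eq_sym rn0.
have {}main q : 0 <= q <= 1 -> q <> r ->
    (if a == c then `|s - q| else s + q) + `|q - r| = (if a == c then `|s - r| else s + r) ->
    `|r - q| + (if c == b then `|q - t| else q + t) = (if c == b then `|r - t| else r + t) ->
    exists m, [/\ m <> spt c r :> star, between (spt a s) (spt c r) m & between (spt c r) (spt b t) m].
  by move=> hq /eqP qr; exact: main.
clear neq hr hs ht.
move: nb main; case: (eqVneq a c) => [E|ac]; [subst c|]; rewrite ?(eq_sym _ b).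
  case: (eqVneq b a) => [E|ab]; [subst b; rewrite ?eqxx|].
    move=> nb main; have [st|ts] := lerP s t.
      have [rs|sr] := ltP r s; first by apply: (main s); clear main nb; solve_main.
      have [tr|rt] := ltP t r; first by apply: (main t); clear main nb; solve_main.
      by exfalso; apply: nb; clear main; norm_lra.
    have [rt|tr] := ltP r t; first by apply: (main t); clear main nb; solve_main.
    have [sr|rs] := ltP s r; first by apply: (main s); clear main nb; solve_main.
    by exfalso; apply: nb; clear main; norm_lra.
  move=> nb main; have [rs|sr] := lerP r s; last by apply: (main s); clear main nb; solve_main.
  by exfalso; apply: nb; rewrite ?(eq_sym _ b) ?(negPf ab); clear main ab; norm_lra.
case: (eqVneq b c) => [E|bc]; [subst b; rewrite ?(negPf ac)|].
  move=> nb main; have [rs|sr] := lerP r t; last by apply: (main t); clear main nb; solve_main.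
  by exfalso; apply: nb; rewrite ?(eq_sym c) ?(negPf ac); clear main ac; norm_lra.
by move=> nb main; apply: (main 0); clear main nb; solve_main.
Qed.

(** This yields uniqueness of arcs. An arc covers the metric interval of its ends by [path_between],
    and it cannot leave the interval, since by [detour] it would visit one point twice. *)
Lemma arc_image x y (B : set star) : is_arc x y B -> B = between x y.
Proof.
case=> g [gc ginj <- <- <-]; apply/seteqP; split=> [_ [t t01 <-]|z zb].
  apply: contrapT => /detour[m [mt xm my]].
  move: t01; rewrite /= in_itv /= => /andP[t0 t1].
  have [p /andP[p0 pt] pm] := path_between gc (lexx 0) t0 t1 xm.
  have [q /andP[tq q1] qm] := path_between gc t0 t1 (lexx 1) my.
  have pq : p = q.
    apply: ginj; rewrite ?in_itv /= ?p0 ?q1 ?(le_trans pt t1) ?(le_trans t0 tq) //.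
    by rewrite pm.
  by apply: mt; rewrite -pm; congr g; apply/le_anti; rewrite pt pq tq.
have [t /andP[t0 t1] <-] := path_between gc (lexx 0) ler01 (lexx 1) zb.
by exists t; rewrite //= in_itv /= t0.
Qed.

Lemma geodesic x y : exists g : R -> star, [/\ g 0 = x, g 1 = y &
  forall p q, 0 <= p <= 1 -> 0 <= q <= 1 -> sdist (g p) (g q) = `|p - q| * sdist x y].
Proof.
have [a [s [/andP[s0 s1] ->]]] := sptP a0 x; have [b [t [/andP[t0 t1] ->]]] := sptP a0 y.
have [<-|ab] := eqVneq a b.
  exists (fun p => spt a (s + p * (t - s))); split.
  - by rewrite mul0r addr0.
  - by rewrite mul1r addrC subrK.
  move=> p q /andP[p0 p1] /andP[q0 q1].
  have conv u : 0 <= u -> u <= 1 -> 0 <= s + u * (t - s) <= 1 by move=> *; apply/andP; split; nra.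
  rewrite !sdist_spt ?conv ?s0 ?t0 // eqxx [`|s - t|]distrC -normrM.
  by congr `|_|; lra.
pose L := s + t.
(* On different arms the path of length [L] runs inward for the length [s], reaches the centre, and
   then runs outward. *)
exists (fun p => if p * L <= s then spt a (s - p * L) else spt b (p * L - s)); split.
- by rewrite mul0r s0 subr0.
- rewrite mul1r /L -[leRHS]addr0 lerD2l [s + t - s]addrAC subrr add0r.
  case: (lerP t 0) => // t00; have -> : t = 0 by lra.
  by rewrite addr0 subrr !spt0.
move=> p q /andP[p0 p1] /andP[q0 q1].
have pL : 0 <= p * L by apply: mulr_ge0; rewrite // addr_ge0.
have qL : 0 <= q * L by apply: mulr_ge0; rewrite // addr_ge0.
have pL1 : p * L <= L by rewrite ler_piMl // addr_ge0.
have qL1 : q * L <= L by rewrite ler_piMl // addr_ge0.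
have -> : `|p - q| * sdist (spt a s) (spt b t) = `|p * L - q * L|.
  rewrite sdist_spt ?s0 ?t0 // (negPf ab) -mulrBl normrM [`|L|]ger0_norm // addr_ge0 //.
move: (p * L) (q * L) pL qL pL1 qL1; rewrite /L => {p0 p1 q0 q1 L p q} p q p0 q0 p1 q1.
case: (lerP p s) => ps; case: (lerP q s) => qs; rewrite sdist_spt ?eqxx ?(eq_sym b) ?(negPf ab);
  try (apply/andP; split; lra); clear ab; norm_lra.
Qed.

Lemma arc_exists x y : x <> y -> is_arc x y (between x y).
Proof.
move=> xy; have [g [g0 g1 gd]] := geodesic x y.
have d0 : 0 < sdist x y.
  by rewrite -mdistE mdist_gt0; apply/eqP.
suff h : is_arc x y (g @` `[0, 1]%classic) by rewrite -(arc_image h).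
exists g; split=> //.
  apply: (lipschitz_within d0) => p q e /=; rewrite !in_itv /= => hp hq.
  rewrite ballEmdist /= mdistE gd // /ball /= => pqe.
  by rewrite [_ * e]mulrC ltr_pM2r.
move=> p q; rewrite !in_itv /= => hp hq E.
have := gd p q hp hq; rewrite E sdistxx => /esym/eqP.
by rewrite mulf_eq0 (gt_eqF d0) orbF normr_eq0 subr_eq0 => /eqP.
Qed.

Lemma star_menger : @menger_convex R star.
Proof.
move=> x y xy; have [g [g0 g1 gd]] := geodesic x y.
have d0 : 0 < sdist x y by rewrite -mdistE mdist_gt0.
have h : 0 <= (2^-1 : R) <= 1 by apply/andP; split; lra.
have e1 : sdist x (g 2^-1) = 2^-1 * sdist x y.
  by rewrite -{1}g0 gd ?lexx ?ler01 // sub0r normrN ger0_norm //; lra.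
have e2 : sdist (g 2^-1) y = 2^-1 * sdist x y.
  rewrite -{1}g1 gd ?lexx ?ler01 //; congr (_ * _).
  by rewrite ler0_norm; lra.
exists (g 2^-1); rewrite !mdistE e1 e2; split; last by lra.
- by apply/eqP => E; move: e1; rewrite E sdistxx; lra.
- by apply/eqP => E; move: e2; rewrite E sdistxx; lra.
Qed.

Lemma star_unique_arc x y : x != y -> exists! B, is_arc x y B.
Proof.
move=> /eqP xy; exists (between x y); split; first exact: arc_exists.
by move=> B /arc_image ->.
Qed.

Hypothesis finA : finite_set [set: A].

Lemma star_compact : compact [set: star].
Proof.
have /finite_seqP[l lE] := finA.
have -> : [set: star] = \big[setU/set0]_(a <- l) (spt a @` `[0, 1]%classic).
  apply/seteqP; split=> // x _; rewrite -bigcup_seq.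
  have [a [s [hs ->]]] := sptP a0 x; exists a; last by exists s; rewrite //= in_itv.
  by have : [set: A] a by []; rewrite lE.
apply: bigsetU_compact => a _; apply: continuous_compact; last exact: segment_compact.
apply: (lipschitz_within ltr01) => p q e /=; rewrite !in_itv /= => hp hq.
by rewrite ballEmdist /= mdistE sdist_spt // eqxx /ball /= mul1r.
Qed.

Lemma star_complete : @complete_metric R star.
Proof.
move=> F PF cF; have := compact_cauchy_cvg PF cF (@filterT _ F _) star_compact.
by move=> cv; exists (lim F); exact: cv.
Qed.

(** Only the centre (a leaf when there is a single arm) and the ends of arms can be leaves. At an
    inner point of the arm [a], a connected set containing the centre and the end of the arm takes
    the value [s] of [crd a], hence contains that point. *)
Lemma star_leaf : finite_set (@leaf R star).
Proof.
apply: (@sub_finite_set _ _ ([set center R A] `|` (fun a => spt a 1) @` [set: A])); last first.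
  by rewrite finite_setU; split; [exact: finite_set1|exact: finite_image].
move=> x lx; have [a [s [/andP[s0 s1] xE]]] := sptP a0 x; subst x.
have [s00|/eqP sn0] := eqVneq s 0; first by left; rewrite s00 spt0.
have [s11|/eqP sn1] := eqVneq s 1; first by right; exists a; rewrite // s11.
exfalso; have [C [C0 CA cC] C1] : connected_component (~` [set spt a s]) (spt a 0) (spt a 1 : star).
  apply: lx.
  - apply/eqP => E; have := @crd_spt a a s; rewrite -E crd_spt ?lexx ?ler01 // eqxx s0 s1.
    by move=> /(_ isT) E'; apply: sn0.
  - apply/eqP => E; have := @crd_spt a a s; rewrite -E crd_spt ?lexx ?ler01 // eqxx s0 s1.
    by move=> /(_ isT) E'; apply: sn1.
have crdc : continuous (crd a : star -> R).
  by apply: (@lip_continuous _ 1) => // u v; rewrite mul1r; exact: crd_lip.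
have /connected_intervalP iv : connected (crd a @` C).
  by apply: connected_continuous_connected => //; exact: continuous_subspaceT.
have [u Cu us] : (crd a @` C) s.
  apply: (iv 0 1); last by rewrite s0 s1.
  - by exists (spt a 0); rewrite // crd_spt ?lexx ?ler01 // eqxx.
  - by exists (spt a 1); rewrite // crd_spt ?lexx ?ler01 // eqxx.
apply: (CA u Cu); apply: crd_eq us.
by rewrite lt_neqAle s0 andbT eq_sym; apply/eqP.
Qed.

(** A point other than the centre has only two sides, told apart by whether [crd a] is below or
    above [s]; of three points, two are on the same side. *)
Lemma star_ramification : finite_set (@ramification_point R star).
Proof.
apply: (@sub_finite_set _ _ [set center R A]); last exact: finite_set1.
move=> x [y1 [y2 [y3 [[n1 n2 n3] [h12 h23 h13]]]]].
have [a [s [/andP[s0 s1] xE]]] := sptP a0 x; subst x.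
have [->|sn0] := eqVneq s 0; first by rewrite /= spt0.
exfalso; have {sn0}s0' : 0 < s by rewrite lt_neqAle eq_sym sn0.
have side y : y != spt a s -> crd a y <> s.
  by move=> /eqP ny E; apply: ny; exact: crd_eq.
have key y z : ~ arc_joined (~` [set spt a s]) y z -> (crd a y <= s <= crd a z) \/
    (crd a z <= s <= crd a y).
  move=> nj; have yz : y <> z by move=> E; apply: nj; left.
  have : between y z (spt a s).
    apply: contrapT => nb; apply: nj; right; exists (between y z); first exact: arc_exists.
    by move=> w wb E; apply: nb; rewrite -E.
  have [b [t [ht ->]]] := sptP a0 y; have [c [r [hr ->]]] := sptP a0 z.
  rewrite /between !crd_spt // !sdist_spt // ?s1 ?(ltW s0') // => {side nj yz}.
  move: ht hr => /andP[t0 t1] /andP[r0 r1].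
  case: (eqVneq b a) => [E|ba]; [subst b|]; case: (eqVneq c a) => [E|ca]; [subst c| |subst c|];
    rewrite ?eqxx ?(eq_sym a) ?(negPf ba) ?(negPf ca) => E.
  - have [ts|st] := lerP t s; have [sr|rs] := lerP s r; [left|right|right|right];
      apply/andP; split; move: E; norm_lra.
  - by right; apply/andP; split; move: E; norm_lra.
  - by left; apply/andP; split; move: E; norm_lra.
  - by exfalso; move: E; case: (b == c); norm_lra.
have := side _ n1; have := side _ n2; have := side _ n3.
have := key _ _ h12; have := key _ _ h23; have := key _ _ h13.
move: (crd a y1) (crd a y2) (crd a y3) => u v w.
move=> [/andP[? ?]|/andP[? ?]] [/andP[? ?]|/andP[? ?]] [/andP[? ?]|/andP[? ?]] nw nv nu;
  try (apply: nw; lra); try (apply: nv; lra); apply: nu; lra.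
Qed.

Lemma star_finite_dendron : @finite_dendron R star.
Proof.
split; [split; [exact: star_complete|exact: star_menger|exact: star_unique_arc]| | | ].
- exact: star_compact.
- exact: star_leaf.
- exact: star_ramification.
Qed.

End StarTheory.

(** * The geometric realization *)

Section AutIsometry.
Variables (R : realType) (G : sgraph).
Local Notation K := (realization R G).
Implicit Types (f g : aut G) (k : gcell G) (p : R * R).

Fact gmap_adj f u v : adj u v -> adj (f u) (f v).
Proof. by rewrite sym_pres. Qed.

Fact gmap_ucycle f a b c d :
  ucycle (@adj G) [:: a; b; c; d] -> ucycle (@adj G) [:: f a; f b; f c; f d].
Proof.
have fi : injective f := can_inj (sym_funK f).
by rewrite /ucycle /= !sym_pres !inE !(inj_eq fi).
Qed.

Definition gmap f k : gcell G :=
  match k with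
  | GVertex v => GVertex (f v)
  | GEdge u v uv => GEdge (gmap_adj f uv)
  | GSquare a b c d h => GSquare (gmap_ucycle f h)
  end.

Lemma gsides_gmap f k : gsides R (gmap f k) = gsides R k.
Proof. by case: k. Qed.

Lemma gchart_gmap f k p w : gchart (gmap f k) p w = gchart k p (sym_inv f w).
Proof.
have at_v v : at_vertex R (f v) w = at_vertex R v (sym_inv f w).
  by rewrite /at_vertex -[in RHS](inj_eq (can_inj (sym_funK f))) sym_invK.
by case: k => [v|u v uv|a b c d h] /=; rewrite !at_v.
Qed.

(** Points of |G| are weight functions on the vertices, so an automorphism acts by composition with
    its inverse, which carries the cell [k] to [gmap f k]. *)
Fact gpoint_act f (x : gpoint R G) : exists k p, l1box (gsides R k) p /\
  (sval x) \o sym_inv f = gchart k p.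
Proof.
case: x => x [k [p [kp xE]]] /=; exists (gmap f k), p; rewrite gsides_gmap.
by split=> //; apply/funext => w; rewrite gchart_gmap xE.
Qed.

Definition gact f (x : cell_space K) : cell_space K := exist _ _ (gpoint_act f x).

Lemma gpoint_eq (x y : gpoint R G) : sval x = sval y -> x = y.
Proof. by case: x y => [x hx] [y hy] /= xy; exact: eq_exist. Qed.

Lemma gact1 : gact 1%g =1 id.
Proof. by move=> x; apply: gpoint_eq; apply/funext. Qed.

Lemma gactM f g : gact (f * g)%g =1 gact f \o gact g.
Proof. by move=> x; apply: gpoint_eq; apply/funext. Qed.

Lemma gact_step f (x y : cell_space K) l : step x y l -> step (gact f x) (gact f y) l.
Proof.
have cellf k (z : cell_space K) : cell (l := K) k z -> cell (l := K) (gmap f k) (gact f z).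
  case=> p kp zE; exists p; rewrite ?gsides_gmap //=.
  by apply/funext => w; rewrite gchart_gmap zE.
have coordf k (z : cell_space K) : cell_coord (l := K) (gmap f k) (gact f z) = cell_coord (l := K) k z.
  by case: k => [v|u v uv|a b c d h] /=; rewrite ?sym_funK.
case=> k [kx ky ->]; exists (gmap f k); split; [exact: cellf|exact: cellf|].
by rewrite !coordf.
Qed.

Lemma gact_chain f (x y : cell_space K) l : chain x y l -> chain (gact f x) (gact f y) l.
Proof.
elim=> [z|u v w m n uv _ ih]; first exact: chain_nil.
by apply: chain_cons ih; exact: gact_step.
Qed.

Lemma gactK f : cancel (gact f) (gact f^-1%g).
Proof. by move=> x; rewrite -[LHS]gactM mulVg gact1. Qed.

Lemma gactVK f : cancel (gact f^-1%g) (gact f).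
Proof. by move=> x; rewrite -[LHS]gactM mulgV gact1. Qed.

Lemma gact_dist f (x y : cell_space K) :
  intrinsic_dist (gact f x) (gact f y) = intrinsic_dist x y.
Proof.
congr ereal_inf; apply/seteqP; split=> _ [l h <-]; exists l => //.
  by rewrite -(gactK f x) -(gactK f y); exact: gact_chain.
exact: gact_chain.
Qed.

Definition gisom f : isometry_group K := Symmetry (gactK f) (gactVK f) (gact_dist f).

Lemma gisomM : {morph gisom : f g / (f * g)%g}.
Proof. by move=> f g; apply: symmetry_ext => x; exact: gactM. Qed.

Definition gvertex (v : G) : cell_space K.
exists (at_vertex R v), (GVertex v), (0, 0); split=> //.
by split; rewrite /= in_itv /= lexx.
Defined.

Lemma gact_vertex f v : gact f (gvertex v) = gvertex (f v).
Proof.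
apply: gpoint_eq; apply/funext => w /=.
by rewrite /at_vertex -[in LHS](inj_eq (can_inj (sym_funK f))) sym_invK.
Qed.

Lemma gvertex_inj : injective gvertex.
Proof.
move=> u v /(congr1 sval) /= /(congr1 (fun h => h u)).
by rewrite /at_vertex eqxx; case: eqP => // _ /eqP; rewrite oner_eq0.
Qed.

Lemma gisom_inj : injective gisom.
Proof.
move=> f g fg; apply: symmetry_ext => v; apply: gvertex_inj.
by rewrite -!gact_vertex -[gact f _]/(gisom f _) fg.
Qed.

End AutIsometry.

(** * Edges of a star and their intersections *)

Section StarEdge.
Variables (R : realType) (A : choiceType) (a0 : A).
Local Notation star := (star R A).
Implicit Types (x y : star) (i j k l : option A) (p q : R).

(** The barycentric weight of [x] at the vertex [i] of the star. *)
Definition wt x i : R := if i is Some a then crd a x else 1 - srad x.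

(** The point at parameter [p] on the edge from [i] to [j], which degenerates to a vertex for
    [i = j]. For two different leaves the value is a default, excluded by [star_edge]. *)
Definition spe i j p : star :=
  match i, j with
  | None, None => center R A
  | Some a, None => spt a (1 - p)
  | None, Some a => spt a p
  | Some a, Some _ => spt a 1
  end.

Definition star_edge i j := (i == j) || star_adj i j.

Definition elen i j : R := (i != j)%:R.

Lemma star_edgeW (P : option A -> option A -> Prop) :
  P None None -> (forall a, P (Some a) (Some a)) ->
  (forall a, P None (Some a)) -> (forall a, P (Some a) None) ->
  forall i j, star_edge i j -> P i j.
Proof.
move=> h1 h2 h3 h4 [a|] [b|] //; rewrite /star_edge /star_adj /= orbF.
by move=> /eqP ->.
Qed.

Lemma onem_itv p : 0 <= p <= 1 -> 0 <= 1 - p <= 1.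
Proof. by move=> /andP[? ?]; apply/andP; split; lra. Qed.

Lemma wt_spe i j p v : star_edge i j -> 0 <= p <= 1 ->
  wt (spe i j p) v = (1 - p) * (v == i)%:R + p * (v == j)%:R.
Proof.
move=> ij p01; have p01' := onem_itv p01; have r1 : 0 <= (1 : R) <= 1 by rewrite ler01 lexx.
move: i j ij; apply: star_edgeW => [|a|a|a]; case: v => [b|] //=;
  rewrite ?rad_spt ?crd_spt // ?eqxx /= ?(inj_eq (@Some_inj _)) ?(eq_sym a) /center /crd /=;
  try (by case: eqP => _ /=; lra); lra.
Qed.

Lemma sdist_spe i j p q : star_edge i j -> 0 <= p <= 1 -> 0 <= q <= 1 ->
  sdist (spe i j p) (spe i j q) = elen i j * `|p - q|.
Proof.
move=> ij p01 q01; have p01' := onem_itv p01; have q01' := onem_itv q01.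
have r1 : 0 <= (1 : R) <= 1 by rewrite ler01 lexx.
move: i j ij; apply: star_edgeW => [|a|a|a]; rewrite /elen ?eqxx /= ?sdistxx ?mul0r //;
  rewrite sdist_spt // eqxx mul1r // distrC; congr `|_|; lra.
Qed.

Definition subedge i j (e : option A * option A) : Prop :=
  [\/ e = (i, i), e = (j, j) | e = (i, j)].

Definition seg i j : set star := spe i j @` `[0, elen i j]%classic.

Lemma subedge_edge i j e : star_edge i j -> subedge i j e -> star_edge e.1 e.2.
Proof. by move=> ij [] -> //=; rewrite /star_edge eqxx. Qed.

Lemma spe0 i j : star_edge i j -> spe i j 0 = spe i i 0.
Proof. by move: i j; apply: star_edgeW => //= a; rewrite ?spt0 ?subr0. Qed.

Lemma spe1 i j : star_edge i j -> spe i j 1 = spe j j 0.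
Proof. by move: i j; apply: star_edgeW => //= a; rewrite ?subrr ?spt0. Qed.

Lemma seg_pt i : seg i i = [set spe i i 0].
Proof.
rewrite /seg /elen eqxx /=; apply/seteqP; split=> [_ [p /= +] <-|_ ->].
  by rewrite in_itv /= => /le_anti <-.
by exists 0; rewrite //= in_itv /= lexx.
Qed.

Lemma seg_face i j (F : set R) : star_edge i j -> interval_face (elen i j) F ->
  exists e, subedge i j e /\ spe i j @` F = seg e.1 e.2.
Proof.
move=> ij [->|->|->].
- exists (i, i); split; first by constructor 1.
  by rewrite image_set1 seg_pt spe0.
- exists (j, j); split; first by constructor 2.
  rewrite image_set1 seg_pt /elen; case: eqP ij => [->|_] ij /=.
    by rewrite spe0.
  by rewrite spe1.
- by exists (i, j); split; first by constructor 3.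
Qed.

Lemma face_seg i j e : star_edge i j -> subedge i j e ->
  exists F, interval_face (elen i j) F /\ spe i j @` F = seg e.1 e.2.
Proof.
move=> ij [->|->|->] /=.
- exists [set 0]; split; first by constructor 1.
  by rewrite image_set1 seg_pt spe0.
- exists [set elen i j]; split; first by constructor 2.
  rewrite image_set1 seg_pt /elen; case: eqP ij => [->|_] ij /=.
    by rewrite spe0.
  by rewrite spe1.
- by exists `[0, elen i j]%classic; split; first by constructor 3.
Qed.

Lemma seg_arm a : seg None (Some a) = [set x | crd a x = srad x].
Proof.
rewrite /seg /elen /=; apply/seteqP; split=> [_ [p /= +] <-|x /= h].
  by rewrite in_itv /= => p01; rewrite crd_spt // eqxx rad_spt.
have [b [s [hs xE]]] := sptP a0 x; subst x; exists s; first by rewrite /= in_itv.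
move: h; rewrite crd_spt // rad_spt //; case: eqP => [-> //|_ <-].
by rewrite !spt0.
Qed.

Lemma seg_sym i j : star_edge i j -> seg i j = seg j i.
Proof.
move: i j; suff h a : seg (Some a) None = seg None (Some a).
  by apply: star_edgeW => // a; rewrite h.
rewrite /seg /elen /=; apply/seteqP; split=> _ [p /= +] <-; rewrite in_itv /= => /onem_itv hp.
  by exists (1 - p); rewrite //= in_itv.
by exists (1 - p); rewrite /= ?in_itv // subKr.
Qed.

(** By the symmetries [symm] and [flip] only two cases remain: a vertex and an arbitrary edge, and
    two edges leaving the centre, which coincide or share just the centre. *)
Lemma seg_meet i j k l : star_edge i j -> star_edge k l ->
  seg i j `&` seg k l = set0 \/
  exists e f, [/\ subedge i j e, subedge k l f,
     seg i j `&` seg k l = seg e.1 e.2 & seg i j `&` seg k l = seg f.1 f.2].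
Proof.
pose Q i j k l := seg i j `&` seg k l = set0 \/
  exists e f, [/\ subedge i j e, subedge k l f,
     seg i j `&` seg k l = seg e.1 e.2 & seg i j `&` seg k l = seg f.1 f.2].
have symm i1 j1 k1 l1 : Q i1 j1 k1 l1 -> Q k1 l1 i1 j1.
  rewrite /Q setIC => -[|[e [f [? ? h1 h2]]]]; [by left|right; exists f, e].
  by split.
have flip i1 j1 k1 l1 : star_edge i1 j1 -> Q j1 i1 k1 l1 -> Q i1 j1 k1 l1.
  move=> ij; rewrite /Q (seg_sym ij) => -[|[e [f [he hf h1 h2]]]]; first by left.
  right; case: he h1 => -> h1; rewrite h1.
  - by exists (j1, j1), f; split=> //; [constructor 2|rewrite -h1].
  - by exists (i1, i1), f; split=> //; [constructor 1|rewrite -h1].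
  - exists (i1, j1), f; split=> //; [by constructor 3| |by rewrite -h1].
    by rewrite /= -seg_sym.
have pt u k1 l1 : star_edge k1 l1 -> Q u u k1 l1.
  move=> kl; have [uk|uk] := pselect (seg k1 l1 (spe u u 0)); last first.
    left; rewrite seg_pt; apply/seteqP; split=> // x [-> //].
  right; have E : seg u u `&` seg k1 l1 = seg u u.
    by apply/setIidPl; rewrite seg_pt => _ ->.
  have [f [hf fE]] : exists f, subedge k1 l1 f /\ seg u u = seg f.1 f.2.
    move: uk; rewrite seg_pt; case=> p; rewrite /= in_itv /= => /andP[p0 p1] pE.
    suff : spe k1 l1 p = spe k1 l1 0 \/ spe k1 l1 p = spe k1 l1 1.
      case; rewrite pE => ->; [rewrite spe0//|rewrite spe1//].
        by exists (k1, k1); split; [constructor 1|rewrite seg_pt].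
      by exists (l1, l1); split; [constructor 2|rewrite seg_pt].
    have r1 : 0 <= (1 : R) <= 1 by rewrite ler01 lexx.
    have r0 : 0 <= (0 : R) <= 1 by rewrite ler01 lexx.
    (* A vertex has radius 0 or 1, so on an edge it can only be an end. *)
    have sr : srad (spe u u 0) = 0 \/ srad (spe u u 0) = 1.
      by case: (u) => [a|]; [right; rewrite /= rad_spt|left].
    clear E; move: k1 l1 kl p1 pE; apply: star_edgeW => [|a|a|a] /=; [by left|by left| |];
    rewrite /elen /= => p1 pE.
      have p01 : 0 <= p <= 1 by rewrite p0.
      by move: sr; rewrite -pE rad_spt // => -[] ->; [left|right].
    have p01 : 0 <= 1 - p <= 1 by apply: onem_itv; rewrite p0.
    by move: sr; rewrite -pE rad_spt // => -[] E'; [right|left]; congr spt; lra.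
  by exists (u, u), f; split=> //; [constructor 1|rewrite E].
have arms a b : Q None (Some a) None (Some b).
  right; have [ab|ab] := eqVneq a b.
    subst b; exists (None, Some a), (None, Some a).
    by rewrite setIid; split=> //; constructor 3.
  exists (None, None), (None, None); rewrite /= seg_pt !seg_arm.
  suff -> : [set x | crd a x = srad x] `&` [set x | crd b x = srad x] = [set spe None None 0].
    by split=> //; constructor 1.
  apply/seteqP; split=> [x /= []|_ ->] /=; last by [].
  have [c [s [hs xE]]] := sptP a0 x; subst x; rewrite !crd_spt // rad_spt //.
  case: (eqVneq c a) => [->|_] h1 h2; last by rewrite -h1 spt0.
  by move: h2; rewrite (negPf ab) => <-; rewrite spt0.
have arm a k1 l1 : star_edge k1 l1 -> Q None (Some a) k1 l1.
  move: k1 l1; apply: star_edgeW => [|b|b|b]; [exact/symm/pt|exact/symm/pt|exact: arms|].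
  by apply/symm/flip => //; exact: arms.
move=> ij kl; change (Q i j k l); move: i j ij; apply: star_edgeW => [|a|a|a].
- exact: pt.
- exact: pt.
- exact: arm.
- by apply: flip => //; exact: arm.
Qed.

End StarEdge.

(** A 4-cycle in a product of two stars is a product of two edges, since a star contains no cycle.
    The alternatives tell which coordinate changes along the first side. *)
Lemma four_cycle_form (A C : choiceType) (a b c d : option A * option C) :
  @cart_adj (star_graph A) (star_graph C) a b ->
  @cart_adj (star_graph A) (star_graph C) b c ->
  @cart_adj (star_graph A) (star_graph C) c d ->
  @cart_adj (star_graph A) (star_graph C) d a -> a != c -> b != d ->
  [/\ b = (b.1, a.2), d = (a.1, d.2), c = (b.1, d.2), star_adj a.1 b.1 & star_adj a.2 d.2] \/
  [/\ b = (a.1, b.2), d = (d.1, a.2), c = (d.1, b.2), star_adj a.2 b.2 & star_adj a.1 d.1].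
Proof.
case: a b c d => [[a1|] [a2|]] [[b1|] [b2|]] [[c1|] [c2|]] [[d1|] [d2|]];
  rewrite /cart_adj /star_adj /= ?(andbF, andbT, orbF) //.
all: do 4?[move=> /eqP[?]; subst | move=> _]; rewrite ?eqxx //.
all: by [left; split|right; split].
Qed.

(** * Cells of the realization as products of star edges *)

Section Form.
Variables (R : realType) (A C : choiceType) (inc : A -> C -> bool).
Local Notation G := (ball_graph inc).
Local Notation K := (realization R G).

(** Weights multiply because the chart of a square is bilinear. Only the weights at compatible pairs
    are recorded. *)
Definition prodw (x : star R A) (y : star R C) (v : G) : R :=
  wt x (val v).1 * wt y (val v).2.

Definition swap_if (m : bool) (p : R * R) : R * R := if m then (p.2, p.1) else p.

(* The cell k is the product of the star edges ii' and jj', with the two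
   coordinates exchanged when m holds. *)
Record cell_form (k : gcell G) i i' j j' (m : bool) : Prop := CellForm {
  form_l : star_edge i i';
  form_r : star_edge j j';
  form_compat : forall u v, u = i \/ u = i' -> v = j \/ v = j' -> compat inc (u, v);
  form_sides : gsides R k = swap_if m (elen R i i', elen R j j');
  form_chart : forall p, l1box (gsides R k) p ->
    gchart k p = prodw (spe i i' (swap_if m p).1) (spe j j' (swap_if m p).2)
}.

Lemma at_vertexE (v w : G) : at_vertex R v w =
  ((val w).1 == (val v).1)%:R * ((val w).2 == (val v).2)%:R.
Proof.
rewrite /at_vertex -val_eqE -natrM mulnb; case: (val w) (val v) => [? ?] [? ?].
by rewrite xpair_eqE.
Qed.

Lemma itv01 (p : R) : p \in `[0, 1] -> 0 <= p <= 1. Proof. by rewrite in_itv. Qed.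
Lemma itv00 (p : R) : p \in `[0, 0] -> p = 0.
Proof. by rewrite in_itv /= => /le_anti. Qed.
Lemma le01 : 0 <= (0 : R) <= 1. Proof. by rewrite lexx ler01. Qed.

Lemma form_vertex (v : G) :
  cell_form (GVertex v) (val v).1 (val v).1 (val v).2 (val v).2 false.
Proof.
split; rewrite /star_edge /elen ?eqxx //.
- by move=> _ _ [] -> [] ->; rewrite -surjective_pairing; exact: valP.
- move=> [p q] [/= /itv00 -> /itv00 ->]; apply/funext => w.
  by rewrite /prodw !wt_spe /star_edge ?eqxx ?le01 // at_vertexE; ring.
Qed.

Lemma form_edge_l (u v : G) (uv : adj u v) :
  star_adj (val u).1 (val v).1 -> (val u).2 = (val v).2 ->
  cell_form (GEdge uv) (val u).1 (val v).1 (val u).2 (val u).2 false.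
Proof.
move=> h1 h2; have e1 : star_edge (val u).1 (val v).1 by rewrite /star_edge h1 orbT.
have e2 : star_edge (val u).2 (val u).2 by rewrite /star_edge eqxx.
have n1 : (val u).1 != (val v).1 by apply: contraTN h1 => /eqP ->; rewrite star_adj_irrefl.
split; rewrite // /elen ?eqxx ?n1 //.
- move=> _ _ [] -> [] ->; rewrite ?{2}h2 -?surjective_pairing; try exact: valP.
  by rewrite h2 -surjective_pairing; exact: valP.
  by rewrite h2 -surjective_pairing; exact: valP.
- move=> [p q] [/= /itv01 hp /itv00 ->]; apply/funext => w.
  by rewrite /prodw !wt_spe ?le01 // !at_vertexE -h2; ring.
Qed.

(** An edge cell always has its length in the first coordinate, so an edge along the second star
    needs the exchange. *)
Lemma form_edge_r (u v : G) (uv : adj u v) :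
  star_adj (val u).2 (val v).2 -> (val u).1 = (val v).1 ->
  cell_form (GEdge uv) (val u).1 (val u).1 (val u).2 (val v).2 true.
Proof.
move=> h1 h2; have e1 : star_edge (val u).2 (val v).2 by rewrite /star_edge h1 orbT.
have e2 : star_edge (val u).1 (val u).1 by rewrite /star_edge eqxx.
have n1 : (val u).2 != (val v).2 by apply: contraTN h1 => /eqP ->; rewrite star_adj_irrefl.
split; rewrite // /elen ?eqxx ?n1 //.
- have hu : compat inc ((val u).1, (val u).2) by rewrite -surjective_pairing; exact: valP.
  have hv : compat inc ((val u).1, (val v).2) by rewrite h2 -surjective_pairing; exact: valP.
  by move=> _ _ [] -> [] ->.
- move=> [p q] [/= /itv01 hp /itv00 ->]; apply/funext => w.
  by rewrite /prodw !wt_spe ?le01 // !at_vertexE -h2; ring.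
Qed.

Lemma form_square_l (a b c d : G) (h : ucycle (@adj G) [:: a; b; c; d]) :
  val b = ((val b).1, (val a).2) -> val d = ((val a).1, (val d).2) ->
  val c = ((val b).1, (val d).2) -> star_adj (val a).1 (val b).1 ->
  star_adj (val a).2 (val d).2 ->
  cell_form (GSquare h) (val a).1 (val b).1 (val a).2 (val d).2 false.
Proof.
move=> hb hd hc h1 h2.
have e1 : star_edge (val a).1 (val b).1 by rewrite /star_edge h1 orbT.
have e2 : star_edge (val a).2 (val d).2 by rewrite /star_edge h2 orbT.
have n1 : (val a).1 != (val b).1 by apply: contraTN h1 => /eqP ->; rewrite star_adj_irrefl.
have n2 : (val a).2 != (val d).2 by apply: contraTN h2 => /eqP ->; rewrite star_adj_irrefl.
split; rewrite // /elen ?n1 ?n2 //.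
- have ca : compat inc ((val a).1, (val a).2) by rewrite -surjective_pairing; exact: valP.
  have cb : compat inc ((val b).1, (val a).2) by rewrite -hb; exact: valP.
  have cc : compat inc ((val b).1, (val d).2) by rewrite -hc; exact: valP.
  have cd : compat inc ((val a).1, (val d).2) by rewrite -hd; exact: valP.
  by move=> _ _ [] -> [] ->.
- move=> [p q] [/= /itv01 hp /itv01 hq]; apply/funext => w.
  rewrite /prodw !wt_spe // !at_vertexE hc /= [in (val w).2 == (val b).2]hb.
  by rewrite [in (val w).1 == (val d).1]hd /=; ring.
Qed.

Lemma form_square_r (a b c d : G) (h : ucycle (@adj G) [:: a; b; c; d]) :
  val b = ((val a).1, (val b).2) -> val d = ((val d).1, (val a).2) ->
  val c = ((val d).1, (val b).2) -> star_adj (val a).2 (val b).2 ->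
  star_adj (val a).1 (val d).1 ->
  cell_form (GSquare h) (val a).1 (val d).1 (val a).2 (val b).2 true.
Proof.
move=> hb hd hc h1 h2.
have e1 : star_edge (val a).2 (val b).2 by rewrite /star_edge h1 orbT.
have e2 : star_edge (val a).1 (val d).1 by rewrite /star_edge h2 orbT.
have n1 : (val a).2 != (val b).2 by apply: contraTN h1 => /eqP ->; rewrite star_adj_irrefl.
have n2 : (val a).1 != (val d).1 by apply: contraTN h2 => /eqP ->; rewrite star_adj_irrefl.
split; rewrite // /elen ?n1 ?n2 //.
- have ca : compat inc ((val a).1, (val a).2) by rewrite -surjective_pairing; exact: valP.
  have cb : compat inc ((val a).1, (val b).2) by rewrite -hb; exact: valP.
  have cc : compat inc ((val d).1, (val b).2) by rewrite -hc; exact: valP.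
  have cd : compat inc ((val d).1, (val a).2) by rewrite -hd; exact: valP.
  by move=> _ _ [] -> [] ->.
- move=> [p q] [/= /itv01 hp /itv01 hq]; apply/funext => w.
  rewrite /prodw !wt_spe // !at_vertexE hc /= [in (val w).1 == (val b).1]hb.
  by rewrite [in (val w).2 == (val d).2]hd /=; ring.
Qed.

Lemma cell_form_exists (k : gcell G) : exists i i' j j' m, cell_form k i i' j j' m.
Proof.
case: k => [v|u v uv|a b c d h].
- by do 5 eexists; exact: form_vertex.
- have := uv; rewrite /= /ball_adj /cart_adj => /orP[] /andP[h1 h2].
    by do 5 eexists; apply: form_edge_r => //; exact/eqP.
  by do 5 eexists; apply: form_edge_l => //; exact/eqP.
- have /andP[/= /and5P[ab bc cd da _]] := h.
  rewrite !inE !negb_or -!andbA => /and5P[_ ac _ _ /andP[bd _]].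
  have [[]|[]] := four_cycle_form ab bc cd da ac bd => *.
    by do 5 eexists; exact: form_square_l.
  by do 5 eexists; exact: form_square_r.
Qed.

(** Compatibility of the four corners is all it takes for a product of star edges to be a cell. This
    supplies faces of cells and the squares used for shortest chains. *)
Lemma cell_form_realized i i' j j' : star_edge i i' -> star_edge j j' ->
  (forall u v, u = i \/ u = i' -> v = j \/ v = j' -> compat inc (u, v)) ->
  exists k m, cell_form k i i' j j' m.
Proof.
move=> ii jj ok.
have c1 := ok i j (or_introl erefl) (or_introl erefl).
have c2 := ok i' j (or_intror erefl) (or_introl erefl).
have c3 := ok i' j' (or_intror erefl) (or_intror erefl).
have c4 := ok i j' (or_introl erefl) (or_intror erefl).
pose a : G := (exist _ (i, j) c1 : ball_vertex inc); pose b : G := (exist _ (i', j) c2 : ball_vertex inc).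
pose c : G := (exist _ (i', j') c3 : ball_vertex inc); pose d : G := (exist _ (i, j') c4 : ball_vertex inc).
have [ei|ni] := eqVneq i i'; have [ej|nj] := eqVneq j j'.
- by subst i' j'; exists (GVertex a), false; exact: (form_vertex a).
- have aj : star_adj j j' by move: jj; rewrite /star_edge (negPf nj).
  subst i'; have ad : adj a d by rewrite /= /ball_adj /cart_adj /= eqxx aj.
  by exists (GEdge ad), true; exact: form_edge_r.
- have ai : star_adj i i' by move: ii; rewrite /star_edge (negPf ni).
  subst j'; have ab : adj a b by rewrite /= /ball_adj /cart_adj /= eqxx ai orbT.
  by exists (GEdge ab), false; exact: form_edge_l.
- have aj : star_adj j j' by move: jj; rewrite /star_edge (negPf nj).
  have ai : star_adj i i' by move: ii; rewrite /star_edge (negPf ni).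
  have h : ucycle (@adj G) [:: a; b; c; d].
    rewrite /ucycle /= /ball_adj /cart_adj /= !eqxx ai aj (star_adj_sym j') (star_adj_sym i').
    rewrite ai aj !orbT /= !inE -!val_eqE /= !xpair_eqE !eqxx (negPf ni) (negPf nj).
    by rewrite !(eq_sym i') (negPf ni).
  by exists (GSquare h), false; exact: (form_square_l h).
Qed.

End Form.

(** * Coordinates of the points of the realization in the two stars *)

Section Coordinates.
Variables (R : realType) (A C : choiceType) (inc : A -> C -> bool).
Local Notation G := (ball_graph inc).
Local Notation K := (realization R G).
Implicit Types (x : star R A) (y : star R C) (z : cell_space K).

Definition armed x y : bool := compat inc (sarm x, sarm y).

Lemma sarm_spe (B : choiceType) (i j : option B) (p : R) : star_edge i j ->
  [\/ sarm (spe i j p) = i, sarm (spe i j p) = j | sarm (spe i j p) = None].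
Proof.
move: i j; apply: star_edgeW => [|b|b|b] /=; rewrite /spt; try case: pselect => h /=;
  by [constructor 1|constructor 2|constructor 3].
Qed.

Lemma armed_spe i i' j j' p q : star_edge i i' -> star_edge j j' ->
  (forall u v, u = i \/ u = i' -> v = j \/ v = j' -> compat inc (u, v)) ->
  armed (spe i i' p) (spe j j' q).
Proof.
move=> ii jj ok; rewrite /armed.
have [->|->|->] := sarm_spe p ii; have [->|->|->] := sarm_spe q jj; rewrite //=;
  try (by apply: ok; auto); by case: (i) => //; case: (i').
Qed.

Lemma sarm_rad (B : choiceType) (x : star R B) b : sarm x = Some b -> 0 < srad x.
Proof. by case: x => [[c|] s] //= /andP[]. Qed.

Lemma rad_None (B : choiceType) (x : star R B) : sarm x = None -> srad x = 0.
Proof. by case: x => [[c|] s] //= /eqP. Qed.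

(** The weight at [lvert inc a] detects the arm unless [y] is the end of an arm [c]. In that case
    the corner of [a] and [c], a vertex of the graph because [x] and [y] are [armed], has positive
    weight. *)
Lemma prodw_arm_l x y x' y' : armed x y -> prodw (inc := inc) x y = prodw x' y' ->
  forall a, sarm x = Some a -> sarm x' = Some a.
Proof.
move=> xy E a xa; have s0 := sarm_rad xa.
apply: contrapT => nx'; have E1 := congr1 (fun h => h (lvert inc a)) E.
have ca : crd a x = srad x by rewrite /crd xa eqxx.
have ca' : crd a x' = 0 by rewrite /crd; case: eqP.
move: E1; rewrite /prodw /= ca ca' mul0r => /eqP.
rewrite mulf_eq0 gt_eqF //= subr_eq0 => /eqP y1.
have [c yc] : exists c, sarm y = Some c.
  case ya : (sarm y) => [c|]; first by exists c.
  by move: y1; rewrite (rad_None ya) => /eqP; rewrite oner_eq0.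
have ac : inc a c by move: xy; rewrite /armed xa yc.
have := congr1 (fun h => h (corner ac)) E; rewrite /prodw /= ca ca' mul0r.
rewrite /crd yc eqxx -y1 mulr1 => s00.
by move: s0; rewrite s00 ltxx.
Qed.

Lemma prodw_arm_r x y x' y' : armed x y -> prodw (inc := inc) x y = prodw x' y' ->
  forall c, sarm y = Some c -> sarm y' = Some c.
Proof.
move=> xy E c yc; have s0 := sarm_rad yc.
apply: contrapT => ny'; have E1 := congr1 (fun h => h (rvert inc c)) E.
have cc : crd c y = srad y by rewrite /crd yc eqxx.
have cc' : crd c y' = 0 by rewrite /crd; case: eqP.
move: E1; rewrite /prodw /= cc cc' mulr0 => /eqP.
rewrite mulf_eq0 [_ == 0 :> R in X in _ || X]gt_eqF //= orbF subr_eq0 => /eqP x1.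
have [a xa] : exists a, sarm x = Some a.
  case xx : (sarm x) => [a|]; first by exists a.
  by move: x1; rewrite (rad_None xx) => /eqP; rewrite oner_eq0.
have ac : inc a c by move: xy; rewrite /armed xa yc.
have := congr1 (fun h => h (corner ac)) E; rewrite /prodw /= cc cc' mulr0.
rewrite /crd xa eqxx -x1 mul1r => s00.
by move: s0; rewrite s00 ltxx.
Qed.

Lemma prodw_inj x y x' y' : armed x y -> armed x' y' ->
  prodw (inc := inc) x y = prodw x' y' -> x = x' /\ y = y'.
Proof.
move=> xy xy' E.
have ex : sarm x = sarm x'.
  case ax : (sarm x) => [a|]; first by rewrite (prodw_arm_l xy E ax).
  by case ax' : (sarm x') => [a|//]; rewrite -ax (prodw_arm_l xy' (esym E) ax').
have ey : sarm y = sarm y'.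
  case ay : (sarm y) => [a|]; first by rewrite (prodw_arm_r xy E ay).
  by case ay' : (sarm y') => [a|//]; rewrite -ay (prodw_arm_r xy' (esym E) ay').
suff [hx hy] : srad x = srad x' /\ srad y = srad y' by split; apply: star_eq.
have E1 := congr1 (fun h => h (cone inc)) E; move: E1; rewrite /prodw /= => E1.
case ax : (sarm x) => [a|]; case ay : (sarm y) => [c|].
- have ac : inc a c by move: xy; rewrite /armed ax ay.
  have := congr1 (fun h => h (lvert inc a)) E; have := congr1 (fun h => h (rvert inc c)) E.
  have := congr1 (fun h => h (corner ac)) E.
  (* Each radius is the sum of the weight at the corner and the weight at the end of its own arm. *)
  rewrite /prodw /= /crd -ex -ey ax ay !eqxx => e1 e2 e3; split.
    have -> : srad x = srad x * srad y + srad x * (1 - srad y) by ring.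
    by rewrite e1 e3; ring.
  have -> : srad y = srad x * srad y + (1 - srad x) * srad y by ring.
  by rewrite e1 e2; ring.
- have y0 := rad_None ay; have y0' : srad y' = 0 by apply: rad_None; rewrite -ey.
  by move: E1; rewrite y0 y0' !subr0 !mulr1 => E1; split=> //; lra.
- have x0 := rad_None ax; have x0' : srad x' = 0 by apply: rad_None; rewrite -ex.
  by move: E1; rewrite x0 x0' !subr0 !mul1r => E1; split=> //; lra.
- have y0 := rad_None ay; have y0' : srad y' = 0 by apply: rad_None; rewrite -ey.
  have x0 := rad_None ax; have x0' : srad x' = 0 by apply: rad_None; rewrite -ex.
  by rewrite x0 x0' y0 y0'.
Qed.

Lemma swap_ifK m : involutive (swap_if (R := R) m).
Proof. by case: m => -[]. Qed.

Lemma swap_box m (s p : R * R) : l1box s (swap_if m p) <-> l1box (swap_if m s) p.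
Proof. by case: m s p => -[? ?] [? ?] //; split=> -[]. Qed.

Lemma rep_exists z : exists xy : star R A * star R C,
  armed xy.1 xy.2 /\ sval z = prodw xy.1 xy.2.
Proof.
case: z => z [k [p [kp zE]]] /=; have [i [i' [j [j' [m []]]]]] := cell_form_exists R k.
move=> ii jj ok sidesE chartE.
exists (spe i i' (swap_if m p).1, spe j j' (swap_if m p).2).
by rewrite zE chartE //; split=> //; exact: armed_spe.
Qed.

(** The projections to the two stars; [pxy_unique] shows that the choice made by [cid] does not
    matter. *)
Definition px z : star R A := (sval (cid (rep_exists z))).1.
Definition py z : star R C := (sval (cid (rep_exists z))).2.

Lemma pxy_armed z : armed (px z) (py z).
Proof. by rewrite /px /py; case: cid => ? []. Qed.

Lemma pxyE z : sval z = prodw (px z) (py z).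
Proof. by rewrite /px /py; case: cid => ? []. Qed.

Lemma pxy_unique z x y : armed x y -> sval z = prodw x y -> px z = x /\ py z = y.
Proof.
by move=> xy zE; apply: prodw_inj => //; [exact: pxy_armed|rewrite -pxyE].
Qed.

Lemma pxy_inj z z' : px z = px z' -> py z = py z' -> z = z'.
Proof. by move=> hx hy; apply: gpoint_eq; rewrite !pxyE hx hy. Qed.

Section InCell.
Variables (k : gcell G) (i i' : option A) (j j' : option C) (m : bool).
Hypothesis F : cell_form R k i i' j j' m.

Lemma cell_chart_pxy z p : l1box (gsides R k) p -> sval z = gchart k p ->
  px z = spe i i' (swap_if m p).1 /\ py z = spe j j' (swap_if m p).2.
Proof.
case: F => ii jj ok sE cE kp zE; apply: pxy_unique; first exact: armed_spe.
by rewrite zE cE.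
Qed.

Lemma chart_of z s t : `[0, elen R i i']%classic s -> `[0, elen R j j']%classic t ->
  px z = spe i i' s -> py z = spe j j' t ->
  l1box (gsides R k) (swap_if m (s, t)) /\ sval z = gchart k (swap_if m (s, t)).
Proof.
case: F => ii jj ok sE cE hs ht zx zy.
have b : l1box (gsides R k) (swap_if m (s, t)).
  by rewrite sE; apply/swap_box; rewrite swap_ifK.
by split=> //; rewrite cE // swap_ifK pxyE zx zy.
Qed.

Lemma chart_box p : l1box (gsides R k) p ->
  `[0, elen R i i']%classic (swap_if m p).1 /\ `[0, elen R j j']%classic (swap_if m p).2.
Proof. by rewrite (form_sides F) => /swap_box[]. Qed.

Lemma cell_restrict (Fl Fr : set R) : Fl `<=` `[0, elen R i i'] -> Fr `<=` `[0, elen R j j'] ->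
  cell (l := K) k `&` cell_coord (l := K) k @^-1` (if m then Fr `*` Fl else Fl `*` Fr) =
  [set z | (spe i i' @` Fl) (px z) /\ (spe j j' @` Fr) (py z)].
Proof.
move=> sl sr; apply/seteqP; split=> z /=.
  case=> -[p kp zE]; rewrite zE gchartK // => hp.
  have [-> ->] := cell_chart_pxy kp zE.
  have [hl hr] : Fl (swap_if m p).1 /\ Fr (swap_if m p).2 by case: (m) hp => -[].
  by split; [exists (swap_if m p).1|exists (swap_if m p).2].
case=> -[s hs xE] [t ht yE].
have [b zE] := chart_of (sl _ hs) (sr _ ht) (esym xE) (esym yE).
split; first by exists (swap_if m (s, t)).
by rewrite zE gchartK //; case: (m).
Qed.

Lemma mem_cell z : cell (l := K) k z <-> seg i i' (px z) /\ seg j j' (py z).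
Proof.
rewrite -[_ /\ _]/([set z | (spe i i' @` `[0, elen R i i']%classic) (px z) /\
  (spe j j' @` `[0, elen R j j']%classic) (py z)] z) -cell_restrict //.
split=> [h|[] //]; split=> //; case: h => p kp zE.
rewrite /= zE gchartK //; have [] := chart_box kp.
by case: (m); case: p {kp zE}.
Qed.

Lemma cell_l1dist z z' : cell (l := K) k z -> cell (l := K) k z' ->
  l1dist (cell_coord (l := K) k z) (cell_coord (l := K) k z') =
  sdist (px z) (px z') + sdist (py z) (py z').
Proof.
case=> p kp zE [q kq zE']; rewrite /= zE zE' !gchartK //.
have [-> ->] := cell_chart_pxy kp zE; have [-> ->] := cell_chart_pxy kq zE'.
have [ii jj ok sE cE] := F.
have abs (e : R) (u v : R) (P : bool) : e = (P%:R) -> `[0, e]%classic u -> `[0, e]%classic v ->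
    [/\ 0 <= u <= 1, 0 <= v <= 1 & e * `|u - v| = `|u - v|].
  move=> ->; rewrite /= !in_itv /=; case: P => /= hu hv.
    by rewrite mul1r.
  move/le_anti: hu => <-; move/le_anti: hv => <-.
  by rewrite lexx ler01 subrr normr0 mulr0.
have [p1 p2] := chart_box kp; have [q1 q2] := chart_box kq.
have [hp1 hq1 e1] := abs _ _ _ _ erefl p1 q1; have [hp2 hq2 e2] := abs _ _ _ _ erefl p2 q2.
rewrite !sdist_spe // e1 e2 /l1dist; case: (m) => //=.
by rewrite addrC.
Qed.

Definition boxset (e : option A * option A) (f : option C * option C) : set (cell_space K) :=
  [set z | seg e.1 e.2 (px z) /\ seg f.1 f.2 (py z)].

Lemma interval_face_sub (e : R) (E : set R) : 0 <= e -> interval_face e E -> E `<=` `[0, e].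
Proof.
by move=> e0 [->|->|->] x //= ->; rewrite in_itv /= ?lexx ?e0.
Qed.

Lemma elen_ge0 (B : choiceType) (u v : option B) : 0 <= elen R u v.
Proof. by rewrite /elen; case: eqP. Qed.

Lemma face_boxset (B : set (cell_space K)) : @face R K k B <->
  exists e f, [/\ subedge i i' e, subedge j j' f & B = boxset e f].
Proof.
have [ii jj ok sE _] := F; have {}sE : sides (l := K) k = swap_if m (elen R i i', elen R j j') := sE.
have box Fl Fr e f : interval_face (elen R i i') Fl -> interval_face (elen R j j') Fr ->
    spe i i' @` Fl = seg e.1 e.2 -> spe j j' @` Fr = seg f.1 f.2 ->
    boxset e f = cell (l := K) k `&`
      cell_coord (l := K) k @^-1` (if m then Fr `*` Fl else Fl `*` Fr).
  move=> hl hr eE fE; rewrite cell_restrict /boxset ?eE ?fE //;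
  by apply: interval_face_sub => //; exact: elen_ge0.
split.
  case=> F1 [F2 [h1 h2 ->]]; rewrite sE in h1 h2.
  pose Fl := if m then F2 else F1; pose Fr := if m then F1 else F2.
  have hl : interval_face (elen R i i') Fl by rewrite /Fl; case: (m) h1 h2.
  have hr : interval_face (elen R j j') Fr by rewrite /Fr; case: (m) h1 h2.
  have [e [he eE]] := seg_face ii hl; have [f [hf fE]] := seg_face jj hr.
  exists e, f; split=> //; rewrite (box _ _ _ _ hl hr eE fE).
  by rewrite /Fl /Fr; case: (m).
case=> e [f [he hf ->]].
have [Fl [hl eE]] := face_seg R ii he; have [Fr [hr fE]] := face_seg R jj hf.
exists (if m then Fr else Fl), (if m then Fl else Fr); rewrite sE; split.
- by case: (m).
- by case: (m).
by rewrite (box _ _ _ _ hl hr eE fE); case: (m).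
Qed.

Lemma cell_boxset : cell (l := K) k = boxset (i, i') (j, j') :> set (cell_space K).
Proof. by apply/seteqP; split=> z /mem_cell. Qed.

End InCell.

(** The pair lies in the cell spanned by the centres and the arms of [x] and [y]. *)
Lemma pxy_exists x y : armed x y -> exists z, px z = x /\ py z = y.
Proof.
move=> xy; have eN (B : choiceType) (u : option B) : star_edge None u.
  by case: u.
have [k [m F]] : exists (k : gcell G) m, cell_form R k None (sarm x) None (sarm y) m.
  apply: cell_form_realized => // _ _ [] -> [] -> //.
  by case: (sarm x).
have rec (B : choiceType) (u : star R B) : u = spe None (sarm u) (srad u) /\
    `[0, elen R None (sarm u)]%classic (srad u).
  rewrite /elen /= in_itv /= rad_ge0 /=; case au : (sarm u) => [b|] /=; last first.
    by rewrite (rad_None au); split=> //; apply: star_eq; rewrite // (rad_None au).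
  rewrite rad_le1; split=> //; have h : 0 < srad u <= 1 by rewrite rad_le1 (sarm_rad au).
  by apply: star_eq; rewrite ?arm_spt // rad_spt // rad_ge0 rad_le1.
have [xE hx] := rec _ x; have [yE hy] := rec _ y.
pose p := swap_if m (srad x, srad y).
have kp : l1box (gsides R k) p by rewrite (form_sides F); apply/swap_box; rewrite swap_ifK.
have hz : exists (k : gcell G) p, l1box (gsides R k) p /\ prodw x y = gchart k p.
  by exists k, p; split=> //; rewrite (form_chart F) // swap_ifK -xE -yE.
exists (exist _ _ hz : cell_space K); exact: pxy_unique.
Qed.

End Coordinates.

(** * The intrinsic metric and the structure of a rectangular complex *)

Section Polygon.
Variables (R : realType) (A C : choiceType) (inc : A -> C -> bool) (a0 : A) (c0 : C).
Local Notation G := (ball_graph inc).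
Local Notation K := (realization R G).
Hypothesis inc_c0 : forall a, inc a c0.
Hypothesis inc_r : forall c, exists a, inc a c.
Implicit Types (x : star R A) (y : star R C) (z : cell_space K).

Definition zdist z z' : R := sdist (px z) (px z') + sdist (py z) (py z').

Lemma step_zdist z z' l : step z z' l -> l = zdist z z'.
Proof.
case=> k [kz kz' ->]; have [i [i' [j [j' [m F]]]]] := cell_form_exists R k.
exact: (cell_l1dist F).
Qed.

Lemma zdist_triangle z2 z1 z3 : zdist z1 z3 <= zdist z1 z2 + zdist z2 z3.
Proof. by rewrite /zdist addrACA lerD // sdist_triangle. Qed.

Lemma chain_zdist z z' l : chain z z' l -> zdist z z' <= l.
Proof.
elim=> [w|u v w m n /step_zdist -> _ ih]; first by rewrite /zdist !sdistxx addr0.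
by apply: le_trans (zdist_triangle v _ _) _; rewrite lerD2l.
Qed.

Lemma spt_arm (B : choiceType) b (u : star R B) : sarm u = None \/ sarm u = Some b ->
  u = spt b (srad u).
Proof.
case=> h; first by rewrite (rad_None h) spt0; apply: star_eq; rewrite // (rad_None h).
have s0 := sarm_rad h.
by apply: star_eq; rewrite ?arm_spt ?rad_spt // ?s0 ?(ltW s0) rad_le1.
Qed.

Lemma step_square z z' a c : inc a c ->
  sarm (px z) = None \/ sarm (px z) = Some a -> sarm (px z') = None \/ sarm (px z') = Some a ->
  sarm (py z) = None \/ sarm (py z) = Some c -> sarm (py z') = None \/ sarm (py z') = Some c ->
  step z z' (zdist z z').
Proof.
move=> ac h1 h2 h3 h4.
have [k [m F]] : exists (k : gcell G) m, cell_form R k None (Some a) None (Some c) m.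
  by apply: cell_form_realized => // _ _ [] -> [] ->.
have mem (B : choiceType) b (u : star R B) : sarm u = None \/ sarm u = Some b ->
    seg None (Some b) u.
  by move=> /spt_arm ->; exists (srad u); rewrite //= in_itv /= rad_ge0 rad_le1.
have kz : cell (l := K) k z by apply/(mem_cell F); split; exact: mem.
have kz' : cell (l := K) k z' by apply/(mem_cell F); split; exact: mem.
by exists k; split=> //; rewrite (cell_l1dist F).
Qed.

Lemma chain_step z z' l : step z z' l -> chain z z' l.
Proof. by move=> h; rewrite -[l]addr0; apply: chain_cons h (chain_nil _). Qed.

(** Every point lies in a square: a missing arm is filled in by [c0] or by a point on the given
    block. *)
Lemma arm_pair x y : armed inc x y -> exists a c, [/\ inc a c,
  sarm x = None \/ sarm x = Some a & sarm y = None \/ sarm y = Some c].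
Proof.
rewrite /armed; case: (sarm x) (sarm y) => [a|] [c|] /=.
- by move=> ac; exists a, c; split=> //; right.
- by move=> _; exists a, c0; split=> //; [right|left].
- by move=> _; have [a ac] := inc_r c; exists a, c; split=> //; [left|right].
- by move=> _; exists a0, c0; split=> //; left.
Qed.

Lemma drop_r z : exists w : cell_space K, [/\ px w = px z, py w = center R C & step z w (srad (py z))].
Proof.
have [w [hx hy]] : exists w : cell_space K, px w = px z /\ py w = center R C :> star R C.
  by apply: pxy_exists; rewrite /armed /=; try case: (sarm (px z)).
exists w; split=> //; have [a [c [ac h1 h2]]] := arm_pair (pxy_armed z).
have -> : srad (py z) = zdist z w.
  rewrite /zdist hx hy sdistxx add0r /sdist; case: eqP => _; rewrite /= ?subr0 ?addr0 //.
  by rewrite ger0_norm // rad_ge0.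
by apply: (step_square ac) => //; rewrite ?hx ?hy //; left.
Qed.

Lemma drop_l z : exists w : cell_space K, [/\ py w = py z, px w = center R A & step z w (srad (px z))].
Proof.
have [w [hx hy]] : exists w : cell_space K, px w = center R A /\ py w = py z :> star R C.
  by apply: pxy_exists; rewrite /armed /=; try case: (sarm (px z)).
exists w; split=> //; have [a [c [ac h1 h2]]] := arm_pair (pxy_armed z).
have -> : srad (px z) = zdist z w.
  rewrite /zdist hx hy sdistxx addr0 /sdist; case: eqP => _; rewrite /= ?subr0 ?addr0 //.
  by rewrite ger0_norm // rad_ge0.
by apply: (step_square ac) => //; rewrite ?hx ?hy //; left.
Qed.

(** A proper arm is required, so the centre shares an arm with nothing, not even with itself;
    [sdist_diff] then covers it. *)
Definition same_arm (B : choiceType) (u v : star R B) := exists b, sarm u = Some b /\ sarm v = Some b.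

Lemma sdist_diff (B : choiceType) (u v : star R B) : ~ same_arm u v -> sdist u v = srad u + srad v.
Proof.
move=> h; rewrite /sdist; case: eqP => // E.
case au : (sarm u) E => [b|] av; first by case: h; exists b.
by rewrite (rad_None au) (rad_None (esym av)) subrr normr0 addr0.
Qed.

Lemma chain_l z z' : py z = center R C -> py z' = center R C ->
  chain z z' (sdist (px z) (px z')).
Proof.
move=> hy hy'; have D : sdist (px z) (px z') = zdist z z' by rewrite /zdist hy hy' sdistxx addr0.
have [[a [h h']]|ns] := pselect (same_arm (px z) (px z')).
  by rewrite D; apply/chain_step/(step_square (inc_c0 a)); rewrite ?hy ?hy'; auto.
have [w [wy wx s1]] := drop_l z; have [w' [wy' wx' s2]] := drop_l z'.
have E : w = w' by apply: pxy_inj; rewrite ?wx ?wx' // wy wy' hy hy'.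
rewrite (sdist_diff ns); apply: chain_cat (chain_step s1) _.
by rewrite E; exact/chain_sym/chain_step.
Qed.

Lemma chain_r z z' : px z = center R A -> px z' = center R A ->
  chain z z' (sdist (py z) (py z')).
Proof.
move=> hx hx'; have D : sdist (py z) (py z') = zdist z z' by rewrite /zdist hx hx' sdistxx add0r.
have [[c [h h']]|ns] := pselect (same_arm (py z) (py z')).
  have [a ac] := inc_r c.
  by rewrite D; apply/chain_step/(step_square ac); rewrite ?hx ?hx'; auto.
have [w [wx wy s1]] := drop_r z; have [w' [wx' wy' s2]] := drop_r z'.
have E : w = w' by apply: pxy_inj; rewrite ?wy ?wy' // wx wx' hx hx'.
rewrite (sdist_diff ns); apply: chain_cat (chain_step s1) _.
by rewrite E; exact/chain_sym/chain_step.
Qed.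

(** If the coordinates in one star share no arm, their geodesic runs through the centre, so it costs
    nothing to drop both points to the other axis and travel there. If both pairs of coordinates
    share their arms, the points lie in a common square. *)
Lemma chain_exists z z' : chain z z' (zdist z z').
Proof.
have [[c [h h']]|ns] := pselect (same_arm (py z) (py z')); last first.
  have [w [wx wy s1]] := drop_r z; have [w' [wx' wy' s2]] := drop_r z'.
  rewrite /zdist (sdist_diff ns) -wx -wx' [X in chain _ _ X]addrCA.
  apply: chain_cat (chain_step s1) _; apply: chain_cat (chain_l wy wy') _.
  exact/chain_sym/chain_step.
have [[a [g g']]|ns] := pselect (same_arm (px z) (px z')); last first.
  have [w [wy wx s1]] := drop_l z; have [w' [wy' wx' s2]] := drop_l z'.
  rewrite /zdist (sdist_diff ns) -wy -wy' -addrA [X in _ + X]addrC.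
  apply: chain_cat (chain_step s1) _; apply: chain_cat (chain_r wx wx') _.
  exact/chain_sym/chain_step.
apply/chain_step/(@step_square _ _ a c); auto.
by have := pxy_armed z; rewrite /armed g h.
Qed.

Lemma intrinsic_distE z z' : intrinsic_dist z z' = (zdist z z')%:E.
Proof.
apply/le_anti/andP; split.
  by apply: ereal_inf_lbound; exists (zdist z z'); [exact: chain_exists|].
by apply/ereal_infP => _ [l h <-]; rewrite lee_fin; exact: chain_zdist.
Qed.

Lemma cell_coord_bij (k : gcell G) :
  set_bij (cell (l := K) k) (l1box (sides (l := K) k)) (cell_coord (l := K) k).
Proof.
split.
- by move=> z [p kp zE]; rewrite /= zE gchartK.
- move=> z z' /set_mem[p kp zE] /set_mem[q kq zE']; rewrite /= zE zE' !gchartK // => pq.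
  by apply: gpoint_eq; rewrite zE zE' pq.
- move=> p kp; have h' : exists (k' : gcell G) p', l1box (gsides R k') p' /\ gchart k p = gchart k' p'.
    by exists k, p.
  exists (exist _ _ h' : gpoint R G); first by exists p.
  by rewrite /= gchartK.
Qed.

(** Everything is reduced to the stars: faces of a cell are products of subedges, intersections are
    formed factor by factor, and the distance within any cell is that of the coordinates in the
    stars. *)
Lemma realization_complex : rectangular_complex K.
Proof.
have real e f i i' j j' m (k : gcell G) : cell_form R k i i' j j' m ->
    subedge i i' e -> subedge j j' f ->
    exists j, cell (l := K) j = (boxset e f : set (cell_space K)).
  move=> [ii jj ok _ _] he hf.
  have [k' [m' F']] : exists (k' : gcell G) m', cell_form R k' e.1 e.2 f.1 f.2 m'.
    apply: cell_form_realized; [exact: subedge_edge ii he|exact: subedge_edge jj hf|].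
    move=> u v hu hv; apply: ok.
      by case: he hu => -> /= []; auto.
    by case: hf hv => -> /= []; auto.
  exists k'; rewrite (cell_boxset F').
  by case: e f {he hf F'} => [? ?] [? ?].
split.
- by move=> [v|u v uv|a b c d h] /=; rewrite ?lexx ?ler01.
- exact: cell_coord_bij.
- by case=> z [k [p [kp zE]]]; exists k; exists p.
- move=> k B; have [i [i' [j [j' [m F]]]]] := cell_form_exists R k.
  by case/(face_boxset F) => e [f [he hf ->]]; exact: real F he hf.
- move=> k k' [F1 [F2 [_ _ fE]]] z z' /set_mem kz /set_mem kz'.
  have [i [i' [j [j' [m F]]]]] := cell_form_exists R k.
  have [l [l' [n [n' [m' F']]]]] := cell_form_exists R k'.
  have sub w : cell (l := K) k' w -> cell (l := K) k w by rewrite fE => -[].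
  by rewrite (cell_l1dist F' kz kz') (cell_l1dist F (sub _ kz) (sub _ kz')).
- move=> k k'.
  have [i [i' [j [j' [m F]]]]] := cell_form_exists R k.
  have [l [l' [n [n' [m' F']]]]] := cell_form_exists R k'.
  have E : cell (l := K) k `&` cell (l := K) k' = [set z | (seg i i' `&` seg l l') (px z) /\
      (seg j j' `&` seg n n') (py z)] :> set (cell_space K).
    rewrite (cell_boxset F) (cell_boxset F'); apply/seteqP; split=> z /=.
      by move=> [[? ?] [? ?]].
    by move=> [[? ?] [? ?]].
  have [M|[e [f [he hf M1 M2]]]] := seg_meet R a0 (form_l F) (form_l F').
    by left; rewrite E M; apply/seteqP; split=> z //= [].
  have [M|[e' [f' [he' hf' M1' M2']]]] := seg_meet R c0 (form_r F) (form_r F').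
    by left; rewrite E M; apply/seteqP; split=> z //= [].
  right; split.
    by apply/(face_boxset F); exists e, e'; split=> //; rewrite E M1 M1'.
  by apply/(face_boxset F'); exists f, f'; split=> //; rewrite E M2 M2'.
Qed.

Lemma realization_polygon : finite_set [set: A] -> finite_set [set: C] ->
  ramified_rectilinear_polygon K.
Proof.
move=> fA fC; split; last first.
  exists (star R A), (star R C); split.
  - exact: star_finite_dendron.
  - exact: star_finite_dendron.
  by exists (@px R A C inc), (@py R A C inc) => z z'; rewrite intrinsic_distE.
split; first exact: realization_complex.
apply: (@sub_finite_set _ _ ((fun u => boxset u.1 u.2 : set (cell_space K)) @`
  (([set: option A] `*` [set: option A]) `*` ([set: option C] `*` [set: option C])))).
  move=> _ [k _ <-]; have [i [i' [j [j' [m F]]]]] := cell_form_exists R k.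
  by exists ((i, i'), (j, j')); rewrite // (cell_boxset F).
by apply/finite_image/finite_setX; apply/finite_setX; exact: finite_option.
Qed.

End Polygon.

(** * Isometries of the realization *)

Section Isometries.
Variables (R : realType) (A C : choiceType) (inc : A -> C -> bool) (a0 : A) (c0 : C).
Local Notation G := (ball_graph inc).
Local Notation K := (realization R G).
Hypothesis inc_l : forall a c, exists2 c', c' != c & inc a c'.
Hypothesis inc_r : forall c a, exists2 a', a' != a & inc a' c.
Hypothesis inc_c0 : forall a, inc a c0.
Implicit Types (z w : cell_space K) (v : G).

Lemma sdist_center (B : choiceType) (u : star R B) : sdist u (center R B) = srad u.
Proof.
by rewrite /sdist; case: eqP => _; rewrite /= ?subr0 ?addr0 // ger0_norm // rad_ge0.
Qed.

Lemma sdist_end (B : choiceType) (u : star R B) b :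
  sdist u (spt b 1) = if sarm u == Some b then 1 - srad u else 1 + srad u.
Proof.
rewrite /sdist arm_spt ?rad_spt ?ltr01 ?lexx ?ler01 //; case: eqP => _; last by rewrite addrC.
by rewrite ler0_norm ?opprB // subr_le0 rad_le1.
Qed.

Lemma pxy_gvertex v : px (gvertex R v) = spe (val v).1 (val v).1 0 /\
  py (gvertex R v) = spe (val v).2 (val v).2 0.
Proof.
have F := form_vertex R v.
have kp : l1box (gsides R (GVertex v)) (0, 0) by split; rewrite /= in_itv /= lexx.
exact: (cell_chart_pxy F (z := gvertex R v) kp erefl).
Qed.

Lemma px_gvertex v : px (gvertex R v) = spe (val v).1 (val v).1 0.
Proof. exact: (pxy_gvertex v).1. Qed.

Lemma py_gvertex v : py (gvertex R v) = spe (val v).2 (val v).2 0.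
Proof. exact: (pxy_gvertex v).2. Qed.

Local Notation o := (gvertex R (cone inc)).

Lemma zdist_o z : zdist z o = srad (px z) + srad (py z).
Proof. by rewrite /zdist px_gvertex py_gvertex !sdist_center. Qed.

Lemma zdist_corner z a c (ac : inc a c) : zdist z (gvertex R (corner ac)) =
  (if sarm (px z) == Some a then 1 - srad (px z) else 1 + srad (px z)) +
  (if sarm (py z) == Some c then 1 - srad (py z) else 1 + srad (py z)).
Proof. by rewrite /zdist px_gvertex py_gvertex /= !sdist_end. Qed.

Lemma zdist_lvert z a : zdist z (gvertex R (lvert inc a)) =
  (if sarm (px z) == Some a then 1 - srad (px z) else 1 + srad (px z)) + srad (py z).
Proof. by rewrite /zdist px_gvertex py_gvertex /= sdist_end sdist_center. Qed.

Lemma zdist_gvertex u v : zdist (gvertex R u) (gvertex R v) = (pdist (val u) (val v))%:R.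
Proof.
have h (B : choiceType) (i j : option B) :
    sdist (spe i i 0 : star R B) (spe j j 0) = (star_dist i j)%:R.
  have r1 : 0 <= (1 : R) <= 1 by rewrite ler01 lexx.
  rewrite /star_dist; case: i j => [b|] [d|] /=.
  - rewrite sdist_spt // (inj_eq (@Some_inj _)); case: eqP => _ /=.
      by rewrite subrr normr0.
    by ring.
  - by rewrite sdist_center rad_spt.
  - by rewrite sdist_sym sdist_center rad_spt.
  - by rewrite sdistxx.
by rewrite /zdist !px_gvertex !py_gvertex !h /pdist natrD.
Qed.

Lemma zdist_eq0 z w : zdist z w = 0 -> z = w.
Proof.
move=> E; have := mdist_ge0 (px z) (px w); have := mdist_ge0 (py z) (py w).
rewrite !mdistE => h1 h2; apply: pxy_inj; apply: sdist_eq0; move: E; rewrite /zdist => E; lra.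
Qed.

Lemma zdist_sym z w : zdist z w = zdist w z.
Proof. by rewrite /zdist sdist_sym [sdist (py z) _]sdist_sym. Qed.

(** A corner that avoids both arms of [z] is at distance 2 plus the two radii of [z]. *)
Lemma o_center z : z = o <-> forall w, zdist z w <= 2.
Proof.
have inc_r' c : exists a, inc a c by have [a _ ac] := inc_r c a0; exists a.
split=> [-> w|h].
  by rewrite zdist_sym zdist_o; have := rad_le1 (px w); have := rad_le1 (py w) => *; lra.
have [a [c [ac h1 h2]]] := arm_pair a0 inc_c0 inc_r' (pxy_armed z).
have [b ba _] := inc_r c0 a; have [d dc bd] := inc_l b c.
have := h (gvertex R (corner bd)); rewrite zdist_corner.
have -> : sarm (px z) == Some b = false.
  by apply/negbTE; case: h1 => -> //; rewrite (inj_eq (@Some_inj _)) eq_sym.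
have -> : sarm (py z) == Some d = false.
  by apply/negbTE; case: h2 => -> //; rewrite (inj_eq (@Some_inj _)) eq_sym.
have := rad_ge0 (px z); have := rad_ge0 (py z) => ? ? ?.
by apply: zdist_eq0; rewrite zdist_o; lra.
Qed.

Lemma at_corner z : zdist z o = 2 -> exists a c (ac : inc a c), z = gvertex R (corner ac).
Proof.
rewrite zdist_o => E; have := rad_le1 (px z); have := rad_le1 (py z) => hy hx.
have x1 : srad (px z) = 1 by lra.
have y1 : srad (py z) = 1 by lra.
have full (B : choiceType) (u : star R B) : srad u = 1 -> exists b, sarm u = Some b /\ u = spt b 1.
  move=> u1; case ub : (sarm u) => [b|].
    by exists b; split=> //; rewrite -u1; apply: spt_arm; right.
  by move: u1; rewrite (rad_None ub) => /esym/eqP; rewrite oner_eq0.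
have [a [xa xE]] := full _ _ x1; have [c [yc yE]] := full _ _ y1.
have ac : inc a c by have := pxy_armed z; rewrite /armed xa yc.
exists a, c, ac; apply: pxy_inj; rewrite ?px_gvertex ?py_gvertex //=.
Qed.

(** Two corners are required because the inner points of the antidiagonal of a square are also at
    distance 1 from the cone, but at distance 1 from only one corner. *)
Definition side_point z := zdist z o = 1 /\ exists w1 w2,
  [/\ w1 <> w2, zdist w1 o = 2, zdist w2 o = 2, zdist z w1 = 1 & zdist z w2 = 1].

Lemma side_bvert s : side_point (gvertex R (bvert inc s)).
Proof.
have D u : zdist (gvertex R u) o = (pdist (val u) (None, None))%:R.
  exact: zdist_gvertex.
split; first by rewrite D; case: s.
case: s => [a|c] /=.
  have [d dc ad] := inc_l a c0.
  exists (gvertex R (corner (inc_c0 a))), (gvertex R (corner ad)).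
  rewrite !zdist_gvertex /pdist /star_dist /= !eqxx; split=> //.
  by move/gvertex_inj => -[E]; move: dc; rewrite E eqxx.
have [a _ ac] := inc_r c a0; have [b ba bc] := inc_r c a.
exists (gvertex R (corner ac)), (gvertex R (corner bc)).
rewrite !zdist_gvertex /pdist /star_dist /= !eqxx; split=> //.
by move/gvertex_inj => -[E]; move: ba; rewrite E eqxx.
Qed.

Lemma side_pointP z : side_point z -> exists s, z = gvertex R (bvert inc s).
Proof.
case; rewrite zdist_o => E [w1 [w2 [ne /at_corner[a [c [ac w1E]]] /at_corner[b [d [bd w2E]]]]]].
rewrite w1E w2E !zdist_corner => h1 h2.
have ab : a = b -> c = d -> False.
  by move=> ab cd; apply: ne; rewrite w1E w2E; congr gvertex; apply: val_inj; rewrite /= ab cd.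
have xg := rad_ge0 (px z); have yg := rad_ge0 (py z).
(* With both radii positive and of sum 1, distance 1 to a corner forces both arms of [z] to be those
   of the corner, so the two corners would coincide. *)
have [y0|x0] : srad (py z) = 0 \/ srad (px z) = 0.
  move: h1 h2; case: eqP => xa; case: eqP => yc; try by (move=> *; lra || (left; lra) || (right; lra)).
  case: eqP => xb; case: eqP => yd; try by (move=> *; lra || (left; lra) || (right; lra)).
  - by exfalso; apply: ab; [move: xb|move: yd]; rewrite ?xa ?yc => -[].
- have x1 : srad (px z) = 1 by lra.
  case xa : (sarm (px z)) => [e|]; last by move: x1; rewrite (rad_None xa) => /esym/eqP; rewrite oner_eq0.
  exists (inl e); apply: pxy_inj; rewrite ?px_gvertex ?py_gvertex /=.
    by rewrite -x1; apply: spt_arm; right.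
  by apply: sdist_eq0; rewrite sdist_center.
- have y1 : srad (py z) = 1 by lra.
  case xa : (sarm (py z)) => [e|]; last by move: y1; rewrite (rad_None xa) => /esym/eqP; rewrite oner_eq0.
  exists (inr e); apply: pxy_inj; rewrite ?px_gvertex ?py_gvertex /=.
    by apply: sdist_eq0; rewrite sdist_center.
  by rewrite -y1; apply: spt_arm; right.
Qed.

(** Three vertices of a square containing [z] suffice. The distances to the cone and to the opposite
    corner force [z'] into that square; the sum and the difference of the radii are then known from
    the cone and from the point [a]. *)
Lemma fixed_by_distances z z' : (forall v, zdist z (gvertex R v) = zdist z' (gvertex R v)) -> z = z'.
Proof.
move=> h.
have inc_r' c : exists a, inc a c by have [a _ ac] := inc_r c a0; exists a.
have [a [c [ac h1 h2]]] := arm_pair a0 inc_c0 inc_r' (pxy_armed z).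
have := h (corner ac); have := h (lvert inc a); have := h (cone inc).
rewrite !zdist_o !zdist_corner !zdist_lvert.
have cx : (if sarm (px z) == Some a then 1 - srad (px z) else 1 + srad (px z)) = 1 - srad (px z).
  by case: h1 => x1; rewrite x1 ?eqxx // (rad_None x1) subr0 addr0.
have cy : (if sarm (py z) == Some c then 1 - srad (py z) else 1 + srad (py z)) = 1 - srad (py z).
  by case: h2 => y1; rewrite y1 ?eqxx // (rad_None y1) subr0 addr0.
rewrite cx cy => e1 e2 e3.
have xg := rad_ge0 (px z'); have yg := rad_ge0 (py z').
have nx : sarm (px z') = None \/ sarm (px z') = Some a.
  case xe : (sarm (px z')) => [e|]; last by left.
  have := sarm_rad xe; move: e3; rewrite xe; case: eqP => [->|_]; first by right.
  by clear -e1 xg yg; case: eqP => _ *; exfalso; lra.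
have ny : sarm (py z') = None \/ sarm (py z') = Some c.
  case xe : (sarm (py z')) => [e|]; last by left.
  have := sarm_rad xe; move: e3; rewrite xe; case: (Some e =P Some c) => [->|_]; first by right.
  by clear -e1 xg yg; case: eqP => _ *; exfalso; lra.
have cx' : (if sarm (px z') == Some a then 1 - srad (px z') else 1 + srad (px z')) = 1 - srad (px z').
  by case: nx => x1; rewrite x1 ?eqxx // (rad_None x1) subr0 addr0.
move: e2; rewrite cx' => e2.
by apply: pxy_inj; rewrite (spt_arm h1, spt_arm h2) (spt_arm nx, spt_arm ny); congr spt; clear -e1 e2 e3 xg yg; lra.
Qed.

Section Isometry.
Variable f : isometry_group K.

Lemma iso_zdist z w : zdist (f z) (f w) = zdist z w.
Proof.
have inc_r' c : exists a, inc a c by have [a _ ac] := inc_r c a0; exists a.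
by have := sym_pres f z w; rewrite !(intrinsic_distE a0 inc_c0 inc_r') => -[].
Qed.

Lemma iso_o : f o = o.
Proof.
apply/o_center => w; rewrite -(sym_invK f w) iso_zdist.
exact: (o_center o).1 erefl _.
Qed.

Lemma iso_vertex v : exists u, f (gvertex R v) = gvertex R u.
Proof.
have side z : side_point z -> side_point (f z).
  move=> [h [w1 [w2 [ne ? ? ? ?]]]]; split; first by rewrite -iso_o iso_zdist.
  exists (f w1), (f w2); rewrite -iso_o !iso_zdist; split=> //.
  by move/(can_inj (sym_funK f)).
case: (ball_vertexP v) => [|a|c|a c ac].
- by exists (cone inc); exact: iso_o.
- have [s sE] := side_pointP (side _ (side_bvert (inl a))).
  by exists (bvert inc s).
- have [s sE] := side_pointP (side _ (side_bvert (inr c))).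
  by exists (bvert inc s).
- have : zdist (f (gvertex R (corner ac))) o = 2.
    by rewrite -iso_o iso_zdist zdist_gvertex.
  by move=> /at_corner[b [d [bd ->]]]; exists (corner bd).
Qed.

End Isometry.

Lemma gisom_surj (f : isometry_group K) : exists g : aut G, gisom R g = f.
Proof.
have [phi phiE] := choice (iso_vertex f).
have [phi' phiE'] := choice (iso_vertex (sym_opp f)).
have phiK : cancel phi phi'.
  by move=> v; apply: (@gvertex_inj R); rewrite -phiE' -phiE /= sym_funK.
have phiK' : cancel phi' phi.
  by move=> v; apply: (@gvertex_inj R); rewrite -phiE -phiE' /= sym_invK.
have adjE u v : adj u v = (zdist (gvertex R u) (gvertex R v) == 1).
  by rewrite zdist_gvertex pnatr_eq1 /= /ball_adj cart_pdist.
have phi_adj u v : adj (phi u) (phi v) = adj u v.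
  by rewrite !adjE -!phiE iso_zdist.
pose g : aut G := Symmetry phiK phiK' phi_adj.
exists g; apply: symmetry_ext => z; apply: fixed_by_distances => v.
rewrite -(phiK' v) -phiE iso_zdist phiE -[gvertex R (phi _)]/(gvertex R (g _)).
by rewrite -gact_vertex -[gact g _]/(gisom R g _) iso_zdist.
Qed.

Lemma aut_isometry : group_isomorphic (aut G) (isometry_group K).
Proof.
apply: (@bijective_group_isomorphic _ _ (@gisom R G)); first exact: gisomM.
have [h hK] := choice gisom_surj.
by exists h => // f; apply: (@gisom_inj R); rewrite hK.
Qed.

End Isometries.

(** * Connectedness after removal of a point *)

Section Cutpoints.
Variables (R : realType) (A C : choiceType) (inc : A -> C -> bool) (a0 : A) (c0 : C).
Local Notation G := (ball_graph inc).
Local Notation K := (realization R G).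
Hypothesis inc_c0 : forall a, inc a c0.
Hypothesis inc_r : forall c, exists a, inc a c.
Implicit Types (x z w : cell_space K) (s t p : R).

(** The constant 2 suits straight segments in a square, where each of the two coordinates changes by
    at most [|p - q|]. *)
Lemma path_component (D : set (cell_space K)) (g : R -> cell_space K) :
  (forall p q, 0 <= p <= 1 -> 0 <= q <= 1 -> zdist (g p) (g q) <= 2 * `|p - q|) ->
  (forall p, 0 <= p <= 1 -> D (g p)) -> connected_component D (g 0) (g 1).
Proof.
move=> glip gD; exists (g @` `[0, 1]%classic); last first.
  by exists 1; rewrite //= in_itv /= ler01 lexx.
split.
- by exists 0; rewrite //= in_itv /= ler01 lexx.
- by move=> _ [p p01 <-]; apply: gD; move: p01; rewrite /= in_itv.
apply: connected_continuous_connected; first exact: segment_connected.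
have k2 : 0 < (2 : R) by [].
apply: (lipschitz_within k2) => p q e; rewrite /= !in_itv /= => hp hq pq.
suff : (intrinsic_dist (g p) (g q) < (2 * e)%:E)%E by [].
rewrite (intrinsic_distE a0 inc_c0 inc_r) lte_fin.
by apply: le_lt_trans (glip p q hp hq) _; rewrite ltr_pM2l.
Qed.

Lemma armed_spt a c s t : inc a c -> armed inc (spt a s) (spt c t).
Proof. by move=> ac; rewrite /armed /spt; case: pselect => ?; case: pselect. Qed.

Definition sqpt a c (ac : inc a c) s t : cell_space K :=
  sval (cid (pxy_exists (armed_spt s t ac))).

Lemma px_sqpt a c (ac : inc a c) s t : px (sqpt ac s t) = spt a s.
Proof. by rewrite /sqpt; case: cid => ? []. Qed.

Lemma py_sqpt a c (ac : inc a c) s t : py (sqpt ac s t) = spt c t.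
Proof. by rewrite /sqpt; case: cid => ? []. Qed.

Lemma sqpt_exists z : exists a c (ac : inc a c) s t,
  [/\ 0 <= s <= 1, 0 <= t <= 1 & z = sqpt ac s t].
Proof.
have [a [c [ac h1 h2]]] := arm_pair a0 inc_c0 inc_r (pxy_armed z).
exists a, c, ac, (srad (px z)), (srad (py z)); rewrite !rad_ge0 !rad_le1; split=> //.
by apply: pxy_inj; rewrite ?px_sqpt ?py_sqpt; exact: spt_arm.
Qed.

Lemma segment_component x a c (ac : inc a c) s t s' t' :
  0 <= s <= 1 -> 0 <= t <= 1 -> 0 <= s' <= 1 -> 0 <= t' <= 1 ->
  (forall p, 0 <= p <= 1 -> sqpt ac (s + p * (s' - s)) (t + p * (t' - t)) <> x) ->
  connected_component (~` [set x]) (sqpt ac s t) (sqpt ac s' t').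
Proof.
move=> hs ht hs' ht' nx.
have conv (u u' p : R) : 0 <= u <= 1 -> 0 <= u' <= 1 -> 0 <= p <= 1 -> 0 <= u + p * (u' - u) <= 1.
  by move=> /andP[u0 u1] /andP[v0 v1] /andP[p0 p1]; apply/andP; split; nra.
have lip (u u' p q : R) : 0 <= u <= 1 -> 0 <= u' <= 1 ->
    `|(u + p * (u' - u)) - (u + q * (u' - u))| <= `|p - q|.
  move=> /andP[u0 u1] /andP[v0 v1].
  have -> : (u + p * (u' - u)) - (u + q * (u' - u)) = (p - q) * (u' - u) by ring.
  rewrite normrM ler_piMr // ler_norml; apply/andP; split; lra.
pose g p := sqpt ac (s + p * (s' - s)) (t + p * (t' - t)).
have -> : sqpt ac s t = g 0 by rewrite /g !mul0r !addr0.
have -> : sqpt ac s' t' = g 1 by rewrite /g !mul1r ![_ + (_ - _)]addrC !subrK.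
apply: path_component => [p q hp hq|p hp]; last exact: nx.
rewrite /zdist /g !px_sqpt !py_sqpt !sdist_spt ?conv // !eqxx.
have := lip s s' p q hs hs'; have := lip t t' p q ht ht'.
by move: `|_| `|_| `|_| => u v w; lra.
Qed.

Lemma segment_avoid x a c (ac : inc a c) s t s' t' :
  0 <= s <= 1 -> 0 <= t <= 1 -> 0 <= s' <= 1 -> 0 <= t' <= 1 ->
  (forall p, 0 <= p <= 1 -> srad (px x) = s + p * (s' - s) ->
    srad (py x) = t + p * (t' - t) -> False) ->
  connected_component (~` [set x]) (sqpt ac s t) (sqpt ac s' t').
Proof.
move=> hs ht hs' ht' nx; apply: segment_component => // p hp E.
have conv (u u' : R) : 0 <= u <= 1 -> 0 <= u' <= 1 -> 0 <= u + p * (u' - u) <= 1.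
  by move: hp => /andP[p0 p1] /andP[u0 u1] /andP[v0 v1]; apply/andP; split; nra.
by apply: (nx p hp); rewrite -E ?px_sqpt ?py_sqpt rad_spt ?conv.
Qed.

Lemma radii0 x a c (ac : inc a c) : srad (px x) = 0 -> srad (py x) = 0 -> x = sqpt ac 0 0.
Proof.
have z0 (B : choiceType) (b : B) (u : star R B) : srad u = 0 -> u = spt b 0.
  by move=> u0; rewrite spt0; apply: sdist_eq0; rewrite sdist_center.
by move=> /z0 h1 /z0 h2; apply: pxy_inj; rewrite ?px_sqpt ?py_sqpt; [exact: h1|exact: h2].
Qed.

(** If [x] is the cone, the base is the block [c0]: every point goes to the outer corner of its
    square, on to the end of the arm [a], and to [c0] through the square of [a] and [c0]. Otherwise
    the base is the cone, reached on a straight segment or, if [x] lies on it, by a detour in the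
    same square. *)
Lemma compl_component x : exists2 b, b <> x &
  forall z, z <> x -> connected_component (~` [set x]) z b.
Proof.
have r0 : 0 <= (0 : R) <= 1 by rewrite lexx ler01.
have r1 : 0 <= (1 : R) <= 1 by rewrite lexx ler01.
set J := connected_component _.
have trans u v w : J u v -> J v w -> J u w by exact: connected_component_trans.
have [[x0 y0]|nz] := pselect (srad (px x) = 0 /\ srad (py x) = 0).
  exists (sqpt (inc_c0 a0) 0 1).
    by move=> E; move: y0; rewrite -E py_sqpt rad_spt // => /eqP; rewrite oner_eq0.
  move=> z zx; have [a [c [ac [s [t [hs ht zE]]]]]] := sqpt_exists z.
  have nst : ~ (s = 0 /\ t = 0).
    by move=> [s0 t0]; apply: zx; rewrite zE s0 t0; exact/esym/radii0.
  have s1 : J z (sqpt ac 1 1).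
    (* Neither radius decreases along this segment, so it could meet the cone only by starting
       there. *)
    rewrite zE; apply: segment_avoid => // p /andP[p0 p1]; rewrite x0 y0 => E1 E2.
    move: hs ht => /andP[s0 s1] /andP[t0 t1]; apply: nst.
    by split; nra.
  have s2 : J (sqpt ac 1 1) (sqpt ac 1 0).
    by apply: segment_avoid => // p hp; rewrite x0 y0 => E1 E2; lra.
  have s3 : sqpt ac 1 0 = sqpt (inc_c0 a) 1 0.
    by apply: pxy_inj; rewrite ?px_sqpt ?py_sqpt // !spt0.
  have s4 : J (sqpt (inc_c0 a) 1 0) (sqpt (inc_c0 a) 1 1).
    by apply: segment_avoid => // p hp; rewrite x0 y0 => E1 E2; lra.
  have s5 : J (sqpt (inc_c0 a) 1 1) (sqpt (inc_c0 a) 0 1).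
    by apply: segment_avoid => // p hp; rewrite x0 y0 => E1 E2; lra.
  have s6 : sqpt (inc_c0 a) 0 1 = sqpt (inc_c0 a0) 0 1.
    by apply: pxy_inj; rewrite ?px_sqpt ?py_sqpt // !spt0.
  rewrite -s6; apply: (trans _ _ _ s1); apply: (trans _ _ _ s2); rewrite s3.
  exact: (trans _ _ _ s4).
exists (sqpt (inc_c0 a0) 0 0).
  by move=> E; apply: nz; rewrite -E px_sqpt py_sqpt !rad_spt.
move=> z zx; have [a [c [ac [s [t [hs ht zE]]]]]] := sqpt_exists z.
have -> : sqpt (inc_c0 a0) 0 0 = sqpt ac 0 0.
  by apply: pxy_inj; rewrite ?px_sqpt ?py_sqpt // !spt0.
have [av|/existsNP[p /not_implyP[hp /contrapT xE]]] := pselect (forall p, 0 <= p <= 1 ->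
    sqpt ac (s + p * (0 - s)) (t + p * (0 - t)) <> x).
  by rewrite zE; exact: segment_component.
have p0 : p <> 0.
  by move=> E; apply: zx; rewrite zE -xE E !mul0r !addr0.
move: (hs) (ht) (hp) => /andP[s0 s1] /andP[t0 t1] /andP[pp0 pp1].
have {}p0 : 0 < p by rewrite lt_neqAle pp0 andbT eq_sym; apply/eqP.
have xs : srad (px x) = s + p * (0 - s).
  by rewrite -xE px_sqpt rad_spt //; apply/andP; split; nra.
have yt : srad (py x) = t + p * (0 - t).
  by rewrite -xE py_sqpt rad_spt //; apply/andP; split; nra.
have p1 : p < 1.
  rewrite lt_neqAle pp1 andbT; apply/eqP => E; apply: nz.
  by rewrite xs yt E; split; ring.
(* Here [x] lies strictly between [z] and the cone. If [z] is on an axis, the detour leaves the axis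
   inside the square and meets it again only at the cone; otherwise it follows two sides of the
   rectangle between [z] and the cone. *)
rewrite zE; have [sE|sn0] := eqVneq s 0; last have [tE|tn0] := eqVneq t 0.
- have tn0 : t != 0.
    by apply/eqP => tE; apply: nz; rewrite xs yt sE tE; split; ring.
  have tp : 0 < t by rewrite lt_neqAle eq_sym tn0.
  have tau : 0 < srad (py x) < t by rewrite yt; apply/andP; split; nra.
  have sig : srad (px x) = 0 by rewrite xs sE; ring.
  apply: (trans _ (sqpt ac 1 t)).
    by apply: segment_avoid => // q hq _ E; move: tau; rewrite E => /andP[]; lra.
  apply: segment_avoid => // q /andP[q0 q1]; rewrite sig => E1 E2.
  have q11 : q = 1 by lra.
  by move: tau; rewrite E2 q11 => /andP[]; lra.
- have sp : 0 < s by rewrite lt_neqAle eq_sym sn0.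
  have sig : 0 < srad (px x) < s by rewrite xs; apply/andP; split; nra.
  have tau : srad (py x) = 0 by rewrite yt tE; ring.
  apply: (trans _ (sqpt ac s 1)).
    by apply: segment_avoid => // q hq E _; move: sig; rewrite E => /andP[]; lra.
  apply: segment_avoid => // q /andP[q0 q1]; rewrite tau => E1 E2.
  have q11 : q = 1 by lra.
  by move: sig; rewrite E1 q11 => /andP[]; lra.
- have sp : 0 < s by rewrite lt_neqAle eq_sym sn0.
  have tp : 0 < t by rewrite lt_neqAle eq_sym tn0.
  have sig : 0 < srad (px x) < s by rewrite xs; apply/andP; split; nra.
  have tau : 0 < srad (py x) < t by rewrite yt; apply/andP; split; nra.
  apply: (trans _ (sqpt ac s 0)).
    by apply: segment_avoid => // q hq E _; move: sig; rewrite E => /andP[]; lra.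
  by apply: segment_avoid => // q hq _ E; move: tau; rewrite E => /andP[]; lra.
Qed.

Lemma no_cutpoint x : ~ cutpoint x.
Proof.
apply; have [b bx h] := compl_component x.
suff -> : ~` [set x] = connected_component (~` [set x]) b by exact: component_connected.
apply/seteqP; split; last exact: connected_component_sub.
by move=> z zx; apply: connected_component_sym; exact: h.
Qed.

End Cutpoints.

End Geometry.

Theorem theorem5 (Gamma : groupType) :
  exists G : sgraph,
    [/\ partial_double_tree G, two_connected G & graph_radius G 2] /\
    group_isomorphic Gamma (aut G) /\
    (finite_set [set: Gamma]%classic -> finite_graph G) /\
    (forall R : realType,
       group_isomorphic (aut G) (isometry_group (realization R G)) /\
       (finite_graph G ->
          ramified_rectilinear_polygon (realization R G) /\
          (forall x : cell_space (realization R G), ~ cutpoint x))).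
Proof.
have [lt lt_wo] := strict_wo_exists Gamma.
have inc_ex c : exists a, frucht_inc lt a c by have [a _ ac] := inc_block lt c (X0 Gamma); exists a.
exists (frucht_graph lt); split; last split; last split.
- split; first exact: ball_partial_double_tree.
  + exact: (ball_two_connected (inc_block lt) (X0 Gamma) (@inc_Omega _ lt)).
  + exact: (ball_radius (inc_point lt) (inc_block lt) (X0 Gamma) (@inc_Omega _ lt)).
- exact: frucht.
- exact: frucht_finite.
move=> R; split.
  exact: (aut_isometry R (X0 Gamma) (inc_point lt) (inc_block lt) (@inc_Omega _ lt)).
move=> finG; split; last first.
  by move=> x; exact: (no_cutpoint (X0 Gamma) (@inc_Omega _ lt) inc_ex).
apply: (realization_polygon R (X0 Gamma) (@inc_Omega _ lt) inc_ex).
(* The assumption concerns the graph, so points and blocks are recovered as coordinates of its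
   vertices; the defaults [X0] and [Omega] stand for coordinates equal to [None]. *)
- apply: (@sub_finite_set _ _ ((fun v : ball_graph (frucht_inc lt) => odflt (X0 Gamma) (val v).1) @` setT)%classic).
    by move=> a _; exists (lvert (frucht_inc lt) a).
  exact: finite_image.
- apply: (@sub_finite_set _ _ ((fun v : ball_graph (frucht_inc lt) => odflt (Omega Gamma) (val v).2) @` setT)%classic).
    by move=> c _; exists (rvert (frucht_inc lt) c).
  exact: finite_image.
Qed.
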